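(* Let $N_t, N_m, N_e$ be positive integers with $N_e < N_t$, put $n = N_t - N_e$, $m = \min(n, N_m)$ and $k = \max(n, N_m)$. Let $\mathbf{H}$ be an $N_m \times n$ random matrix with i.i.d. circularly symmetric complex Gaussian entries of zero mean and unit variance. Let $\eta > 0$, $g > 0$, $r_s > 0$, and set $R_s = r_s \ln(1+g\eta)$. Define $$P_{out}^{ZF} = \Pr\Big[\ln\det\Big(I_{N_m} + \tfrac{\eta}{n}\mathbf{H}\mathbf{H}^{\dagger}\Big) < R_s\Big].$$ Then for all positive coefficients $a_1,\dots,a_m$ satisfying $a_m \le \dots \le a_1$ and $\sum_{l=1}^m a_l = r_s$, $$P_{out}^{ZF} \ge \prod_{l=1}^m \Gamma_{inc}\big(\xi(a_l), k+m-2l+1\big),$$ where $\xi(x) = \frac{n}{\eta}\big((1+g\eta)^x - 1\big)$.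
   Context: $\Gamma_{inc}(x,a) = \frac{1}{(a-1)!}\int_0^x t^{a-1}e^{-t}\,dt$ for $x \ge 0$ and positive integer $a$. $\mathbf{H}^\dagger$ is the conjugate transpose. $P_{out}^{ZF}$ is the outage probability of the zero-forcing transmit scheme for the MIMO wiretap channel with SNR $\eta$, array gain $g$ and secrecy multiplexing gain $r_s$. *)

(* Defs.v *)
From HB Require Import structures.
From mathcomp Require Import all_boot all_order all_algebra.
From mathcomp Require Import all_classical all_reals all_analysis.
From mathcomp Require Import complex.

Set Implicit Arguments.
Unset Strict Implicit.
Unset Printing Implicit Defensive.

Import Order.TTheory GRing.Theory Num.Theory.
Import numFieldNormedType.Exports.

Local Open Scope classical_set_scope.
Local Open Scope ring_scope.

Definition mutually_independent {R : realType} {d : measure_display}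
  {T : measurableType d} (P : probability T R) (I : finType)
  (X : I -> {RV P >-> R}) : Prop :=
  forall (J : {set I}) (B : I -> set R),
    (forall i, measurable (B i)) ->
    P (\big[setI/setT]_(i in J) (X i @^-1` B i)) =
    (\big[*%E/1%E]_(i in J) P (X i @^-1` B i))%E.

(* A circularly symmetric complex Gaussian of zero mean and unit variance is
   Z = U + i V with U, V independent N(0, 1/2).  An Nm x n matrix with i.i.d.
   CN(0,1) entries is thus given by the 2*Nm*n real random variables
   Xre/im (i,j,b) (b = true: real part, b = false: imaginary part), mutually
   independent, each with distribution N(0, 1/2) (standard deviation sqrt(1/2)). *)
Definition iid_CN01 {R : realType} {d : measure_display}
  {T : measurableType d} (P : probability T R) (Nm n : nat)
  (X : 'I_Nm * 'I_n * bool -> {RV P >-> R}) : Prop :=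
  mutually_independent X /\
  forall i (A : set R), measurable A ->
    distribution P (X i) A = normal_prob 0 (Num.sqrt (2^-1)) A.

Definition gauss_mx {R : realType} {d : measure_display}
  {T : measurableType d} {P : probability T R} {Nm n : nat}
  (X : 'I_Nm * 'I_n * bool -> {RV P >-> R}) (w : T) : 'M[R[i]]_(Nm, n) :=
  \matrix_(i, j) Complex (X (i, j, true) w) (X (i, j, false) w).

Definition ctrmx {R : rcfType} {p q : nat} (A : 'M[R[i]]_(p, q)) : 'M[R[i]]_(q, p) :=
  map_mx conjc (A^T).

(* Outage probability of the zero-forcing scheme:
   Pr[ ln det(I_Nm + (eta/n) H H^dagger) < r_s ln(1 + g eta) ].
   The determinant is of a Hermitian positive definite matrix, hence a
   positive real; we take its real part before applying ln. *)
Definition P_out_ZF {R : realType} {d : measure_display}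
  {T : measurableType d} (P : probability T R) {Nm n : nat}
  (X : 'I_Nm * 'I_n * bool -> {RV P >-> R}) (eta g rs : R) : \bar R :=
  P [set w | ln (complex.Re (\det (1%:M + ((eta / n%:R)%:C)%C *: (gauss_mx X w *m ctrmx (gauss_mx X w)))))
             < rs * ln (1 + g * eta)].

Definition Gamma_inc {R : realType} (x : R) (a : nat) : R :=
  ((a.-1)`!%:R)^-1 *
  Rintegral lebesgue_measure `[0, x] (fun t : R => t ^+ a.-1 * expR (- t)).

Definition xi {R : realType} (n : nat) (eta g : R) (x : R) : R :=
  n%:R / eta * ((1 + g * eta) `^ x - 1).

(* Main.v *)
(** Write [W] for the random matrix and [c = eta / n], and
[^H] for the conjugate transpose.  Conditionally on the first
row, rotating the columns so that this row becomes [(sqrt rho, 0, .., 0)]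
preserves both [W W^H] and the law of the remaining rows, since the standard
Gaussian law is invariant under rotations of pairs of coordinates.  If [u] is
the first column afterwards and [W'] the matrix obtained by deleting the first
row and column, then [W W^H = u u^H + W' W'^H] (with [W'] padded by zeros), so
[det (I + c W W^H) <= (1 + c |u|^2) det (I + c W' W'^H)].  Here [|u|^2] is a sum
of [n + N_m - 1] independent exponential variables (one per complex entry) and is
independent of [W'], which is again an i.i.d. Gaussian matrix.  Iterating, the
events [|u_l|^2 < xi(a_l)] are independent, have probability
[Gamma_inc (xi(a_l), n + N_m - 2l + 1)], and together force
[det (I + c W W^H) < prod_l (1 + c xi(a_l)) = (1 + g eta)^(r_s)]. *)

Require Import Defs.
From HB Require Import structures.
From mathcomp Require Import all_boot all_order all_algebra.
From mathcomp Require Import all_classical all_reals all_analysis.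
From mathcomp Require Import measurable_realfun complex.
From mathcomp Require Import ring lra zify.

Import Order.TTheory GRing.Theory Num.Theory.
Import numFieldNormedType.Exports.

Local Open Scope classical_set_scope.
Local Open Scope ring_scope.

Set Implicit Arguments.
Unset Strict Implicit.
Unset Printing Implicit Defensive.

(** * Lebesgue integrals on the line and in the plane *)

(** No conditional distribution is ever constructed. [gauss_given] expresses that variables are
    i.i.d. Gaussian given [Y] by a product formula over events on [Y], and [Y] carries exactly the
    data on which the next rotation angle depends. The unitary that aligns a row is split into
    rotations of two real coordinates, whose angles are random but functions of [Y]; hence only the
    planar Gaussian law has to be known to be rotation invariant, and only plane integrals are
    computed. The bound on [|u_l|^2] is imposed by restricting the measure to that event, without
    normalising. The remaining matrix is again i.i.d. Gaussian for the restricted measure, so the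
    induction runs over finite measures and carries the total mass as a factor. The determinant
    inequality is the rank-one formula [det (A + c u u^H) = det A (1 + c u^H A^-1 u)] with [A >= I].
    Of the [n + N_m - 1] exponential variables, [n] come from the first row, whose squared norm ends
    up in the pivot, and [N_m - 1] from the entries below the pivot. *)

Section lebesgue_affine.
Context {R : realType}.
Notation mu := (@lebesgue_measure R).

Let aff (a b x : measurableTypeR R) : measurableTypeR R := a * x + b.

Let measurable_aff a b : measurable_fun setT (aff a b).
Proof.
apply: measurable_funD; last exact: measurable_cst.
exact: measurable_funM.
Qed.

Let push_aff a b : {measure set (measurableTypeR R) -> \bar R} :=
  measure_function_pushforward__canonical__measure_function_Measure
    mu (measurable_aff a b).

(** Both sides are measures in [A], so intervals []u, v]] suffice. For [a < 0] the preimage is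
    closed on the left and open on the right, which leaves its length unchanged. *)
Let lebesgue_measure_affine (a b : R) (A : set R) : a != 0 -> measurable A ->
  mu A = (`|a|%:E * mu (aff a b @^-1` A))%E.
Proof.
move=> a0 mA.
pose m := mscale (NngNum (normr_ge0 a)) (push_aff a b).
suff -> : mu A = m A by [].
apply: lebesgue_measure_unique => // _ [[u v] _ <-]/=.
rewrite /m /mscale/= /pushforward.
have [uv|vu] := ltP u v; last first.
  by rewrite set_itv_ge ?preimage_set0 ?measure0 ?mule0// bnd_simp -leNgt.
rewrite lebesgue_measure_itv/= lte_fin uv.
case: (ltgtP a 0) a0 => // sa _.
- have -> : aff a b @^-1` `]u, v] = `[(v - b) / a, (u - b) / a[%classic.
    apply/seteqP; split => x/=; rewrite !in_itv/= /aff.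
      by rewrite ler_ndivrMr// ltr_ndivlMr// mulrC => /andP[? ?]; apply/andP; split; lra.
    by rewrite ler_ndivrMr// ltr_ndivlMr// mulrC => /andP[? ?]; apply/andP; split; lra.
  rewrite lebesgue_measure_itv/= lte_fin ltr_nM2r ?invr_lt0// ltrD2r uv.
  rewrite ltr0_norm// -!EFinD -EFinM; congr (_%:E).
  by field; rewrite lt_eqF.
- have -> : aff a b @^-1` `]u, v] = `](u - b) / a, (v - b) / a]%classic.
    apply/seteqP; split => x/=; rewrite !in_itv/= /aff.
      by rewrite ler_pdivlMr// ltr_pdivrMr// mulrC => /andP[? ?]; apply/andP; split; lra.
    by rewrite ler_pdivlMr// ltr_pdivrMr// mulrC => /andP[? ?]; apply/andP; split; lra.
  rewrite lebesgue_measure_itv/= lte_fin ltr_pM2r ?invr_gt0// ltrD2r uv.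
  rewrite gtr0_norm// -!EFinD -EFinM; congr (_%:E).
  by field; rewrite gt_eqF.
Qed.

Lemma integral_lebesgue_affine (a b : R) (f : R -> \bar R) : a != 0 ->
  measurable_fun setT f -> (forall x, 0 <= f x)%E ->
  (\int[mu]_x f x = `|a|%:E * \int[mu]_x f (a * x + b)%R)%E.
Proof.
move=> a0 mf f0.
pose m := mscale (NngNum (normr_ge0 a)) (push_aff a b).
rewrite (eq_measure_integral m); last first.
  by move=> A mA _; exact: lebesgue_measure_affine.
rewrite ge0_integral_mscale//= ge0_integral_pushforward//.
Qed.

Lemma integral_lebesgue_scale (a b : R) (f : R -> \bar R) : a != 0 ->
  measurable_fun setT f -> (forall x, 0 <= f x)%E ->
  (\int[mu]_x f (a * x + b)%R = `|a|^-1%:E * \int[mu]_x f x)%E.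
Proof.
move=> a0 mf f0.
rewrite (integral_lebesgue_affine b a0 mf f0) muleA -EFinM.
by rewrite mulVf ?normr_eq0// mul1e.
Qed.

End lebesgue_affine.

Section normal_prob_integral.
Context {R : realType}.
Notation mu := (@lebesgue_measure R).

(** The change of variables involves a Radon-Nikodym derivative, determined only up to a null set.
    It equals [normal_pdf] almost everywhere because both have the same integral over every
    measurable set. *)
Lemma integral_normal_prob (m s : R) (f : measurableTypeR R -> \bar R) :
  (normal_prob m s).-integrable setT f ->
  (\int[normal_prob m s]_x f x = \int[mu]_x (f x * (normal_pdf m s x)%:E))%E.
Proof.
move=> intf; have mf := measurable_int _ intf.
have mpdf : measurable_fun setT (fun x : measurableTypeR R => (normal_pdf m s x)%:E).
  by apply/measurable_EFinP; exact: measurable_normal_pdf.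
rewrite -(Radon_Nikodym_change_of_variables (@normal_prob_dominates R m s))//=.
apply: ae_eq_integral => //.
- apply: emeasurable_funM => //; apply: (measurable_int mu).
  by apply: Radon_Nikodym_integrable; exact: normal_prob_dominates.
- exact: emeasurable_funM.
- apply: ae_eqe_mul2l => /=.
  rewrite Radon_NikodymE//=; first exact: normal_prob_dominates.
  move=> nmu; case: cid => /= h [h1 h2 h3].
  apply: integral_ae_eq => //=.
  by move=> E _ mE; rewrite -h3.
Qed.

End normal_prob_integral.

Section plane_integrals.
Context {R : realType}.
Notation mu := (@lebesgue_measure R).
Local Notation RR := (measurableTypeR R * measurableTypeR R)%type.

(** The rotation is decomposed into substitutions in one variable. For [c] nonzero and [y] fixed,
    [u = c x - s y] turns the second coordinate into [y / c + s u / c]; after an exchange of the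
    integrals this becomes the new variable in place of [y]. The Jacobians [1 / |c|] and [|c|]
    cancel. *)
Lemma integral_plane_rotation (c s : R) (g : RR -> \bar R) :
  c ^+ 2 + s ^+ 2 = 1 -> measurable_fun setT g -> (forall z, 0 <= g z)%E ->
  (\int[mu]_x \int[mu]_y g (c * x - s * y, s * x + c * y)%R =
   \int[mu]_x \int[mu]_y g (x, y))%E.
Proof.
move=> cs1 mg g0.
have mrot : measurable_fun setT
    (fun z : RR => (c * z.1 - s * z.2, s * z.1 + c * z.2)%R : RR).
  apply: measurable_fun_pair.
    by apply: measurable_funB; apply: measurable_funM.
  by apply: measurable_funD; apply: measurable_funM.
rewrite (fubini_tonelli (fun z : RR =>
  g (c * z.1 - s * z.2, s * z.1 + c * z.2)%R))//=; last first.
  exact: (measurableT_comp mg mrot).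
(* For [c = 0] the rotation is a quarter turn: the coordinates are exchanged, up to signs. *)
have [c0|c0] := eqVneq c 0.
  have s0 : s != 0.
    by apply/eqP => s0; move: cs1; rewrite c0 s0 expr0n/= addr0 => /eqP; rewrite eq_sym oner_eq0.
  have ns1 : `|s| = 1.
    apply/eqP; rewrite -(@eqrXn2 _ 2)// expr1n real_normK ?num_real//.
    by rewrite -cs1 c0 expr0n/= add0r.
  transitivity (\int[mu]_y \int[mu]_x g (- s * y + 0, x)%R)%E.
    apply: eq_integral => y _.
    rewrite (_ : (fun x => _) = fun x => g (- s * y + 0, s * x + 0)%R)%E; last first.
      by apply/funext => x; rewrite c0 !mul0r sub0r addr0 mulNr addr0.
    rewrite (@integral_lebesgue_scale _ s 0 (fun x => g (- s * y + 0, x)%R))//.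
      by rewrite ns1 invr1 mul1e.
    apply: (measurableT_comp mg).
    by apply: measurable_fun_pair => //; exact: measurable_cst.
  rewrite (@integral_lebesgue_scale _ (- s) 0 (fun y => \int[mu]_x g (y, x))%E).
  - by rewrite normrN ns1 invr1 mul1e.
  - by rewrite oppr_eq0.
  - exact: (measurable_fun_fubini_tonelli_F (m2 := mu) g).
  - by move=> x; exact: integral_ge0.
pose h (z : RR) : RR := (z.1, (c^-1 * z.2 + s * z.1 / c)%R).
have mh : measurable_fun setT h.
  apply: measurable_fun_pair => //.
  apply: measurable_funD; first exact: measurable_funM.
  by apply: measurable_funM => //; apply: measurable_funM.
have mgh : measurable_fun setT (g \o h) by exact: measurableT_comp.
have gh0 z : (0 <= (g \o h) z)%E by exact: g0.
transitivity (\int[mu]_y (`|c|^-1%:E * \int[mu]_u g (h (u, y))))%E.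
  apply: eq_integral => y _.
  rewrite -(@integral_lebesgue_scale _ c (- (s * y)) (fun u => g (h (u, y)))) //.
    apply: eq_integral => x _; congr (g _).
    rewrite /h/=; congr (_, _)%R.
    have -> : s * x + c * y = s * x + c ^+ 2 * y / c by field.
    have -> : c ^+ 2 = 1 - s ^+ 2 by rewrite -cs1; ring.
    by field.
  exact: (measurable_fun_pair1 (f := g \o h)).
rewrite ge0_integralZl//; last 2 first.
- exact: (measurable_fun_fubini_tonelli_G (m1 := mu) (g \o h) mgh gh0).
- by move=> y _; exact: integral_ge0.
rewrite -(fubini_tonelli (g \o h))//=.
rewrite -ge0_integralZl//; last 2 first.
- exact: (measurable_fun_fubini_tonelli_F (m2 := mu) (g \o h) mgh gh0).
- by move=> y _; exact: integral_ge0.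
apply: eq_integral => x _; rewrite /h/=.
rewrite (@integral_lebesgue_scale _ c^-1 (s * x / c) (fun v => g (x, v))) ?invr_eq0//.
  by rewrite muleA -EFinM normfV invrK mulVf ?normr_eq0// mul1e.
by apply: (measurableT_comp mg); exact: measurable_fun_pair.
Qed.

Lemma ge0_even_integralT (f : R -> \bar R) : measurable_fun setT f ->
  (forall x, 0 <= f x)%E -> (forall x, f (- x) = f x) ->
  (\int[mu]_x f x = 2%:E * \int[mu]_(x in `[0%R, +oo[) f x)%E.
Proof.
move=> mf f0 fe.
have UT : `]-oo, 0%R[ `|` `[0%R, +oo[ = [set: R].
  by rewrite -itv_bndbnd_setU// set_itvE.
rewrite -{1}UT ge0_integral_setU//=; last 2 first.
- by rewrite UT.
- apply/disj_setPLR => x/=; rewrite !in_itv/= andbT => ?; apply/negP.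
  by rewrite -ltNge.
suff -> : (\int[mu]_(x in `]-oo, 0%R[) f x = \int[mu]_(x in `[0%R, +oo[) f x)%E.
  by rewrite -[X in (X + X)%E]mul1e -ge0_muleDl//.
rewrite -integral_itv_obnd_cbnd; last exact: measurable_funTS.
rewrite [LHS]integral_mkcond [RHS]integral_mkcond/=.
have mf1 : measurable_fun setT (f \_ `]-oo, 0%R[).
  by apply/(measurable_restrictT _ _).1 => //; exact: measurable_funTS.
rewrite (@integral_lebesgue_affine _ (-1) 0 _ _ mf1) ?oppr_eq0 ?oner_eq0//.
  rewrite normrN1 mul1e; apply: eq_integral => x _.
  rewrite addr0 mulN1r !patchE !mem_setE/= !in_itv/= andbT oppr_lt0 fe.
  by [].
by move=> x; rewrite patchE; case: ifP.
Qed.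

End plane_integrals.

Section radial_integral.
Context {R : realType}.
Notation mu := (@lebesgue_measure R).
Local Notation RR := (measurableTypeR R * measurableTypeR R)%type.

Variables (Phi phi : R -> R) (y : R).
Hypothesis y0 : 0 < y.
Hypothesis cphi : continuous phi.
Hypothesis dPhi : forall w : R, is_derive w (1 : R) Phi (phi w).
Hypothesis phi0 : forall w, 0 <= w < y -> 0 <= phi w.

Let k (w : R) : R := if w < y then phi w else 0.

Let k_ge0 w : 0 <= w -> 0 <= k w.
Proof. by move=> w0; rewrite /k; case: ifP => // wy; rewrite phi0// w0. Qed.

Let mphi : measurable_fun setT phi.
Proof. exact: continuous_measurable_fun. Qed.

Let mk : measurable_fun setT k.
Proof. by apply: measurable_fun_ifT => //; exact: measurable_fun_ltr. Qed.

(** Substitution [w = u ^+ 2 * q]: the factor 2 due to evenness cancels the one in [dw = 2 q u du],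
    and the cutoff [w < y] becomes [u < b] with [b] the square root of [y / q]. *)
Let integral_ray (q : R) : 0 < q ->
  (\int[mu]_u (`|u| * k (u ^+ 2 * q))%:E = ((Phi y - Phi 0) / q)%:E)%E.
Proof.
move=> q0.
have q0' : q != 0 by rewrite gt_eqF.
have q2 : q * 2 != 0 by rewrite mulf_neq0.
rewrite ge0_even_integralT; last 3 first.
- apply/measurable_EFinP; apply: measurable_funM => //=.
  by apply: measurableT_comp => //; apply: measurable_funM.
- by move=> x; rewrite lee_fin mulr_ge0// k_ge0// mulr_ge0 ?sqr_ge0// ltW.
- by move=> x; rewrite normrN sqrrN.
pose b := Num.sqrt (y / q).
have yq : 0 < y / q by rewrite divr_gt0.
have b0 : 0 < b by rewrite sqrtr_gt0.
have b2 : b ^+ 2 = y / q by rewrite sqr_sqrtr// ltW.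
have cu : continuous (fun u : R => u * phi (u ^+ 2 * q)).
  move=> u; apply: continuousM; first exact: cvg_id.
  apply: (@continuous_comp _ _ _ (fun u : R => u ^+ 2 * q) phi); last exact: cphi.
  by apply: continuousM; [exact: exprn_continuous|exact: cst_continuous].
have -> : (\int[mu]_(u in `[0%R, +oo[) (`|u| * k (u ^+ 2 * q))%:E =
           \int[mu]_(u in `[0%R, b]) (u * phi (u ^+ 2 * q))%:E)%E.
  rewrite -integral_itv_bndo_bndc; last first.
    by apply/measurable_funTS/measurable_EFinP; exact: continuous_measurable_fun.
  rewrite [LHS]integral_mkcond [RHS]integral_mkcond/=.
  apply: eq_integral => x _; rewrite !patchE !mem_setE/= !in_itv/= andbT.
  have [x0|//] := leP 0 x; rewrite /k.
  have -> : (x ^+ 2 * q < y) = (x < b).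
    by rewrite -ltr_pdivlMr// -b2 ltr_pXn2r ?nnegrE ?(ltW b0).
  by rewrite ger0_norm//=; case: ifP => // _; rewrite mulr0.
have dF (x : R) : is_derive x 1 (fun u => Phi (u ^+ 2 * q) / (q * 2)) (x * phi (x ^+ 2 * q)).
  have d1 : is_derive x (1 : R) (fun u => u ^+ 2 * q) (2 * x * q).
    apply: is_derive_eq; rewrite /GRing.scale/=.
    by ring.
  have d2 := @is_derive1_comp _ Phi (fun u => u ^+ 2 * q) x _ _ (dPhi (x ^+ 2 * q)) d1.
  apply: is_derive_eq; rewrite /GRing.scale/=.
  by field.
have cF : continuous (fun u : R => Phi (u ^+ 2 * q) / (q * 2)).
  by move=> x; apply: differentiable_continuous; apply/derivable1_diffP; exact: ex_derive.
rewrite (@continuous_FTC2 _ _ (fun u => Phi (u ^+ 2 * q) / (q * 2)))//.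
- rewrite -EFinB -EFinM; congr (_%:E).
  rewrite b2 divfK// expr0n/= mul0r.
  by field.
- by apply: continuous_subspaceT.
- split.
  + by move=> x _; exact: ex_derive.
  + by apply: cvg_at_right_filter; exact: cF.
  + by apply: cvg_at_left_filter; exact: cF.
- by move=> x _; rewrite derive1E; exact: derive_val.
Qed.

Let integral_oneDsqr : (\int[mu]_x (1 + x ^+ 2)^-1%:E = pi%:E)%E.
Proof.
rewrite ge0_even_integralT; last 3 first.
- apply/measurable_EFinP; apply: continuous_measurable_fun => x.
  exact: continuous_oneDsqrV.
- by move=> x; rewrite lee_fin invr_ge0 addr_ge0// sqr_ge0.
- by move=> x; rewrite sqrrN.
rewrite (integral0y_oneDsqr R) -EFinM; congr (_%:E).
by field.
Qed.

(* Polar coordinates without angles: for fixed x, substitute z = x t, then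
   exchange the order of integration. *)
Lemma integral_plane_radial :
  (\int[mu]_x \int[mu]_z (if (x ^+ 2 + z ^+ 2 < y)%R
                          then phi (x ^+ 2 + z ^+ 2)%R else 0%R)%:E =
   (pi * (Phi y - Phi 0))%:E)%E.
Proof.
have k0 (x z : R) : 0 <= k (x ^+ 2 + z ^+ 2) by rewrite k_ge0// addr_ge0 ?sqr_ge0.
have k1 (x t : R) : 0 <= `|x| * k (x ^+ 2 * (1 + t ^+ 2)).
  by rewrite mulr_ge0// k_ge0// mulr_ge0 ?addr_ge0 ?sqr_ge0.
have mk1 : measurable_fun setT
    (fun z : RR => (`|z.1| * k (z.1 ^+ 2 * (1 + z.2 ^+ 2)))%:E).
  apply/measurable_EFinP; apply: measurable_funM => /=.
    by apply: measurableT_comp.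
  apply: (measurableT_comp mk); apply: measurable_funM.
    by apply: measurable_funX.
  by apply: measurable_funD => //; apply: measurable_funX.
have mk0 : measurable_fun setT
    (fun z : RR => (k (z.1 ^+ 2 + z.2 ^+ 2))%:E).
  apply/measurable_EFinP; apply: measurableT_comp => //.
  by apply: measurable_funD; exact: measurable_funX.
transitivity (\int[mu]_x \int[mu]_t (`|x| * k (x ^+ 2 * (1 + t ^+ 2)))%:E)%E.
  apply: ge0_ae_eq_integral => //.
  - by apply: (measurable_fun_fubini_tonelli_F (m2 := mu) _ mk0) => z; rewrite lee_fin k0.
  - by apply: (measurable_fun_fubini_tonelli_F (m2 := mu) _ mk1) => z; rewrite lee_fin k1.
  - by move=> x _; apply: integral_ge0 => z _; rewrite lee_fin; exact: k0.
  - by move=> x _; apply: integral_ge0 => z _; rewrite lee_fin; exact: k1.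
  (* The substitution [z = x t] breaks down only at [x = 0], a null set. *)
  exists [set 0%R]; split => //; first exact: lebesgue_measure_set1.
  move=> x /= xP; apply: contrapT => x0; apply: xP => _.
  have {}x0 : x != 0 by apply/eqP.
  rewrite (@integral_lebesgue_affine _ x 0 (fun z => (k (x ^+ 2 + z ^+ 2))%:E))//.
  - rewrite -ge0_integralZl//.
    + by apply: eq_integral => t _; rewrite -EFinM; congr (_ * k _)%:E; ring.
    + apply/measurable_EFinP; apply: measurableT_comp => //.
      apply: measurable_funD => //; apply: measurable_funX.
      by apply: measurable_funD => //; exact: measurable_funM.
    + by move=> t _; rewrite lee_fin k0.
  - apply/measurable_EFinP; apply: measurableT_comp => //.
    by apply: measurable_funD => //; exact: measurable_funX.
  - by move=> z; rewrite lee_fin k0.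
rewrite [LHS](@fubini_tonelli _ _ _ _ R mu mu _ mk1)/=; last by move=> z; rewrite lee_fin k1.
(* For fixed [t] the integral over [x] is a ray integral with [q = 1 + t ^+ 2]. The factor [pi] then
   comes from integrating [1 / (1 + t ^+ 2)] over the line. *)
transitivity (\int[mu]_t ((Phi y - Phi 0)%:E * (1 + t ^+ 2)^-1%:E))%E.
  apply: eq_integral => t _; rewrite integral_ray//.
  by rewrite (lt_le_trans ltr01)// lerDl sqr_ge0.
have P0 : 0 <= Phi y - Phi 0.
  have := @integral_ray 1 ltr01; rewrite divr1 -lee_fin => <-.
  apply: integral_ge0 => u _; rewrite lee_fin mulr_ge0//.
  by rewrite k_ge0// mulr_ge0 ?sqr_ge0.
rewrite ge0_integralZl//.
- by rewrite integral_oneDsqr -EFinM mulrC.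
- apply/measurable_EFinP; apply: continuous_measurable_fun => x.
  exact: continuous_oneDsqrV.
- by move=> t _; rewrite lee_fin invr_ge0 addr_ge0// sqr_ge0.
Qed.

End radial_integral.

(** * Gaussian pairs and Gamma distribution functions *)

Section truncated_exp.
Context {R : realType}.
Implicit Types (t x y : R) (a : nat).

Definition exp_partial a t : R := \sum_(i < a) t ^+ i / i`!%:R.

Lemma exp_partial0 t : exp_partial 0 t = 0.
Proof. by rewrite /exp_partial big_ord0. Qed.

Lemma exp_partialS a t :
  exp_partial a.+1 t = exp_partial a t + t ^+ a / a`!%:R.
Proof. by rewrite /exp_partial big_ord_recr. Qed.

Lemma exp_partial_at0 a : exp_partial a.+1 0 = 1.
Proof.
rewrite /exp_partial big_ord_recl expr0 fact0 divr1 big1 ?addr0// => i _.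
by rewrite expr0n mul0r.
Qed.

Lemma is_derive_exp_partial a t :
  is_derive t (1 : R) (exp_partial a.+1) (exp_partial a t).
Proof.
elim: a => [|a IH].
  rewrite (_ : exp_partial 1 = cst 1).
    by apply: is_derive_eq; rewrite exp_partial0.
  by apply/funext => x; rewrite exp_partialS exp_partial0 add0r expr0 fact0 divr1.
have d2 : is_derive t (1 : R) (fun x => x ^+ a.+1 / a.+1`!%:R)
    (t ^+ a / a`!%:R).
  have dX : is_derive t (1 : R) (fun x => x ^+ a.+1) (a.+1%:R * t ^+ a).
    rewrite (_ : (fun x => x ^+ a.+1) = id ^+ a.+1 :> (R -> R)); last first.
      by apply/funext => x; rewrite fctE.
    by apply: is_derive_eq; rewrite /GRing.scale/= mulr1.
  apply: is_derive_eq; rewrite factS natrM /GRing.scale/=.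
  by field; rewrite ?natr1 ?nat1r !pnatr_eq0 -?lt0n ?fact_gt0.
rewrite (_ : exp_partial a.+2 =
  exp_partial a.+1 + (fun x => x ^+ a.+1 / a.+1`!%:R)).
  by apply: is_derive_eq (is_deriveD IH d2) _; rewrite exp_partialS.
by apply/funext => x; rewrite exp_partialS.
Qed.

Lemma continuous_exp_partial a : continuous (exp_partial a).
Proof.
case: a => [|a] t.
  rewrite (_ : exp_partial 0 = cst 0); first exact: cst_continuous.
  by apply/funext => x; rewrite exp_partial0.
apply: differentiable_continuous; apply/derivable1_diffP.
exact: (@ex_derive _ _ _ _ _ _ _ (is_derive_exp_partial a t)).
Qed.

(* The distribution function of a sum of a exponential variables of rate 1,
   that is, of a point mass at 0 when a = 0. *)
Definition gamma_cdf a y : R :=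
  if y <= 0 then 0 else 1 - expR (- y) * exp_partial a y.

Lemma gamma_cdf0 y : gamma_cdf 0 y = (0 < y)%R%:R.
Proof.
by rewrite /gamma_cdf exp_partial0 mulr0 subr0 leNgt; case: ltP.
Qed.

(** Since [exp_partial a.+1] has derivative [exp_partial a], differentiating [F] leaves only the
    last term of the truncated series, which is the normalised integrand of [Gamma_inc]. *)
Lemma gamma_cdfE a x : 0 < x -> gamma_cdf a.+1 x = Gamma_inc x a.+1.
Proof.
move=> x0; rewrite /gamma_cdf leNgt x0/= /Gamma_inc.
pose F t := - (expR (- t) * exp_partial a.+1 t).
have dF t : is_derive t (1 : R) F (a`!%:R^-1 * (t ^+ a * expR (- t))).
  have dE := is_derive_exp_partial a t.
  apply: is_derive_eq; rewrite exp_partialS /GRing.scale/=.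
  by field; rewrite pnatr_eq0 -lt0n fact_gt0.
have cF : continuous F.
  by move=> t; apply: differentiable_continuous; apply/derivable1_diffP; exact: ex_derive.
have cf : continuous (fun t : R => t ^+ a * expR (- t)).
  move=> t.
  apply: (@continuousM _ _ (fun t : R => t ^+ a) (fun t : R => expR (- t))).
    exact: exprn_continuous.
  apply: (@continuous_comp _ _ _ (fun t : R => - t) expR).
    exact: opp_continuous.
  exact: continuous_expR.
have ci : continuous (fun t : R => a`!%:R^-1 * (t ^+ a * expR (- t))).
  move=> t; apply: (@continuousM _ _ (fun=> a`!%:R^-1) (fun t : R => t ^+ a * expR (- t))); last exact: cf.
  exact: cst_continuous.
transitivity (fine (\int[lebesgue_measure]_(t in `[0%R, x])
  (a`!%:R^-1 * (t ^+ a * expR (- t)))%:E)%E).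
  rewrite (@continuous_FTC2 _ _ F)//.
  - rewrite -EFinB/= /F exp_partial_at0 oppr0 expR0; ring.
  - exact: continuous_subspaceT.
  - split.
    + by move=> t _; exact: ex_derive.
    + by apply: cvg_at_right_filter; exact: cF.
    + by apply: cvg_at_left_filter; exact: cF.
  - by move=> t _; rewrite derive1E; exact: derive_val.
rewrite -/(Rintegral _ _ _) RintegralZl//.
apply: continuous_compact_integrable; first exact: segment_compact.
exact: continuous_subspaceT.
Qed.

Lemma gamma_cdf_ge0 a y : 0 <= gamma_cdf a y.
Proof.
case: a => [|a]; first by rewrite gamma_cdf0 ler0n.
have [y0|y0] := leP y 0; first by rewrite /gamma_cdf y0.
rewrite gamma_cdfE// /Gamma_inc mulr_ge0//.
apply: Rintegral_ge0 => t; rewrite /= in_itv/= => /andP[t0 _].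
by rewrite mulr_ge0 ?exprn_ge0 ?expR_ge0.
Qed.

Lemma exp_partial_ge0 a y : 0 <= y -> 0 <= exp_partial a y.
Proof. by move=> y0; apply: sumr_ge0 => i _; rewrite divr_ge0 ?exprn_ge0. Qed.

Lemma gamma_cdf_le1 a y : gamma_cdf a y <= 1.
Proof.
rewrite /gamma_cdf; case: ifPn => [_|]; first exact: ler01.
rewrite -ltNge => y0; rewrite gerBl mulr_ge0 ?expR_ge0//.
exact/exp_partial_ge0/ltW.
Qed.

Lemma measurable_gamma_cdf a : measurable_fun setT (gamma_cdf a).
Proof.
apply: measurable_fun_ifT => //; first exact: measurable_fun_ler.
apply: measurable_funB => //; apply: measurable_funM.
  by apply: measurableT_comp.
by apply: continuous_measurable_fun; exact: continuous_exp_partial.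
Qed.

End truncated_exp.

Section gauss_plane.
Context {R : realType}.
Notation mu := (@lebesgue_measure R).
Local Notation RR := (measurableTypeR R * measurableTypeR R)%type.

(* The law of the real and imaginary parts of a CN(0,1) variable. *)
Definition half_normal : probability (measurableTypeR R) R :=
  normal_prob 0 (Num.sqrt 2^-1).

Local Notation N := half_normal.

Lemma half_normal_pdfE (x : R) :
  normal_pdf 0 (Num.sqrt 2^-1) x = (Num.sqrt pi)^-1 * expR (- x ^+ 2).
Proof.
rewrite normal_pdfE ?gt_eqF ?sqrtr_gt0 ?invr_gt0//.
rewrite /normal_peak /normal_fun sqr_sqrtr ?invr_ge0// subr0.
congr ((Num.sqrt _)^-1 * expR _); first by rewrite -mulr_natr; field.
by rewrite -mulr_natr; field.
Qed.

Let bounded_integrable (f : measurableTypeR R -> R) (M : R) :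
  measurable_fun setT f -> (forall x, 0 <= f x <= M) ->
  N.-integrable setT (EFin \o f).
Proof.
move=> mf f0M; apply: measurable_bounded_integrable => //.
  by rewrite -ge0_fin_numE// fin_num_measure.
exists M; split; first exact: num_real.
move=> x Mx y _ /=; apply: le_trans (ltW Mx).
by have /andP[f0 fM] := f0M y; rewrite ger0_norm.
Qed.

(** The planar law has density [exp (- |z|^2) / pi], introduced one coordinate at a time. The bound
    [M] supplies the integrability that each passage to a density requires. *)
Let integral_half_normal2 (f : RR -> R) (M : R) :
  measurable_fun setT f -> (forall z, 0 <= f z <= M) ->
  (\int[N \x N]_z (f z)%:E =
   \int[mu]_x \int[mu]_y
     (f (x, y) * (pi^-1 * expR (- (x ^+ 2 + y ^+ 2))))%:E)%E.
Proof.
move=> mf f0M.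
have mEf : measurable_fun setT (EFin \o f) by exact/measurable_EFinP.
have f0 z : (0 <= (EFin \o f) z)%E by rewrite lee_fin; case/andP: (f0M z).
have mfx x : measurable_fun setT (fun y => f (x, y)) by exact: measurable_fun_pair2.
rewrite fubini_tonelli1//.
pose F (x : measurableTypeR R) := fine (\int[N]_y (f (x, y))%:E)%E.
have Ffin (x : R) : (0 <= \int[N]_y (f (x, y))%:E <= M%:E)%E.
  apply/andP; split; first by apply: integral_ge0 => y _; exact: (f0 (x, y)).
  apply: (@le_trans _ _ (\int[N]_y M%:E)%E).
    apply: ge0_le_integral => //.
    - by move=> y _; exact: (f0 (x, y)).
    - exact/measurable_EFinP.
    - by move=> y _; rewrite lee_fin; case/andP: (f0M (x, y)).
  by rewrite integral_cst//= probability_setT mule1.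
have FE x : (F x)%:E = (\int[N]_y (f (x, y))%:E)%E.
  rewrite fineK// ge0_fin_numE; last by case/andP: (Ffin x).
  by case/andP: (Ffin x) => _ /le_lt_trans; apply; rewrite ltry.
have mF : measurable_fun setT F.
  apply/measurable_EFinP.
  rewrite (_ : EFin \o F = fubini_F N (EFin \o f)); last first.
    by apply/funext => x /=; rewrite FE.
  exact: measurable_fun_fubini_tonelli_F.
transitivity (\int[N]_x (F x)%:E)%E.
  by apply: eq_integral => x _; rewrite FE.
rewrite integral_normal_prob; last first.
  by apply: (@bounded_integrable F M) => // x; rewrite -!lee_fin FE.
apply: eq_integral => x _.
rewrite FE integral_normal_prob; last first.
  by apply: (@bounded_integrable (fun y => f (x, y)) M).
rewrite -ge0_integralZr//; last 3 first.
- apply/measurable_EFinP/measurable_funM => //; exact: measurable_normal_pdf.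
- move=> y _; rewrite lee_fin mulr_ge0 ?normal_pdf_ge0//.
  by case/andP: (f0M (x, y)).
- by rewrite lee_fin normal_pdf_ge0.
apply: eq_integral => y _; rewrite -!EFinM !half_normal_pdfE; congr (_%:E).
rewrite opprD expRD -[in RHS](@sqr_sqrtr _ pi) ?pi_ge0//.
by field; rewrite gt_eqF// sqrtr_gt0 pi_gt0.
Qed.

(** The planar density depends on [x ^+ 2 + y ^+ 2] only, so the rotation invariance of Lebesgue
    integrals carries over. *)
Let rotation (c s : R) (S : set RR) :
  c ^+ 2 + s ^+ 2 = 1 -> measurable S ->
  ((N \x N) [set z | S (c * z.1 - s * z.2, s * z.1 + c * z.2)%R] = (N \x N) S)%E.
Proof.
move=> cs1 mS.
pose rot (z : RR) : RR := (c * z.1 - s * z.2, s * z.1 + c * z.2).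
have mrot : measurable_fun setT rot.
  apply: measurable_fun_pair.
    by apply: measurable_funB; apply: measurable_funM.
  by apply: measurable_funD; apply: measurable_funM.
have mrS : measurable (rot @^-1` S) by rewrite -[_ @^-1` _]setTI; exact: mrot.
pose g (z : RR) : R := \1_S z * (pi^-1 * expR (- (z.1 ^+ 2 + z.2 ^+ 2))).
have mg : measurable_fun setT g.
  apply: measurable_funM => //; apply: measurable_funM => //.
  apply: measurableT_comp => //; apply: measurableT_comp => //.
  by apply: measurable_funD; apply: measurable_funX.
have g0 z : (0 <= (g z)%:E)%E.
  by rewrite lee_fin mulr_ge0// mulr_ge0 ?expR_ge0// invr_ge0 pi_ge0.
have N2E (A : set RR) : measurable A -> ((N \x N) A =
    \int[mu]_x \int[mu]_y
     (\1_A (x, y) * (pi^-1 * expR (- (x ^+ 2 + y ^+ 2))))%:E)%E.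
  move=> mA; rewrite -(@integral_half_normal2 \1_A 1)//.
    rewrite integral_indic; [by rewrite setIT|exact: measurableT|exact: mA].
  by move=> z; rewrite indicE; case: (_ \in _); rewrite ?ler01 ?lexx.
have mEg : measurable_fun setT (EFin \o g) by exact/measurable_EFinP.
rewrite (N2E S mS).
have <- := integral_plane_rotation cs1 mEg g0.
transitivity ((N \x N) (rot @^-1` S))%E; first by [].
rewrite (N2E _ mrS).
apply: eq_integral => x _; apply: eq_integral => z _.
rewrite /g /=; congr (_ * (_ * expR (- _)))%:E.
transitivity ((c ^+ 2 + s ^+ 2) * (x ^+ 2 + z ^+ 2)); last by ring.
by rewrite cs1 mul1r.
Qed.

(** One convolution step: [|z|^2] is exponential of rate 1, and adding it to an independent variable
    of distribution function [gamma_cdf a] raises the parameter by one. *)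
Let radial_gamma_cdf a y :
  (\int[N \x N]_z (gamma_cdf a (y - (z.1 ^+ 2 + z.2 ^+ 2)))%:E =
   (gamma_cdf a.+1 y)%:E)%E.
Proof.
rewrite (@integral_half_normal2 _ 1); last 2 first.
- apply: measurableT_comp; first exact: measurable_gamma_cdf.
  apply: measurable_funB => //.
  by apply: measurable_funD; apply: measurable_funX.
- by move=> z; rewrite gamma_cdf_ge0 gamma_cdf_le1.
have [y0|y0] := leP y 0.
  rewrite {2}/gamma_cdf y0 integral0_eq// => x _.
  rewrite integral0_eq// => z _; rewrite /gamma_cdf ifT ?mul0r//=.
  by rewrite subr_le0 (le_trans y0)// addr_ge0 ?sqr_ge0.
(* [phi] is [gamma_cdf a (y - w)] times the planar density at [|z|^2 = w], in the range [w < y];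
   beyond it [gamma_cdf] vanishes, which gives the cutoff of the radial integral. [Phi] is an
   antiderivative of [phi], again because [exp_partial a.+1] differentiates to [exp_partial a]. *)
pose phi (w : R) : R := pi^-1 * (expR (- w) - expR (- y) * exp_partial a (y - w)).
pose Phi (w : R) : R := pi^-1 * (expR (- y) * exp_partial a.+1 (y - w) - expR (- w)).
have phiE w : w < y -> gamma_cdf a (y - w) * (pi^-1 * expR (- w)) = phi w.
  move=> wy; rewrite /gamma_cdf subr_le0 leNgt wy/= /phi.
  have -> : expR (- y) = expR (- (y - w)) * expR (- w).
    by rewrite -expRD; congr expR; ring.
  by ring.
transitivity (\int[mu]_x \int[mu]_z (if (x ^+ 2 + z ^+ 2 < y)%R
                          then phi (x ^+ 2 + z ^+ 2)%R else 0%R)%:E)%E.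
  apply: eq_integral => x _; apply: eq_integral => z _; congr (_%:E) => /=.
  case: ltP => wy; first by rewrite phiE.
  by rewrite /gamma_cdf subr_le0 wy mul0r.
have cphi : continuous phi.
  move=> w.
  apply: (@continuousM _ _ (fun=> pi^-1)
    (fun w : R => expR (- w) - expR (- y) * exp_partial a (y - w))); first exact: cst_continuous.
  apply: (@continuousB _ _ _ (fun w : R => expR (- w))
    (fun w : R => expR (- y) * exp_partial a (y - w))).
    apply: (@continuous_comp _ _ _ (fun w : R => - w) expR).
      exact: opp_continuous.
    exact: continuous_expR.
  apply: (@continuousM _ _ (fun=> expR (- y))
    (fun w : R => exp_partial a (y - w))); first exact: cst_continuous.
  apply: (@continuous_comp _ _ _ (fun w : R => y - w) (exp_partial a)).
    by apply: (@continuousB _ _ _ (fun=> y) (fun w : R => w)); [exact: cst_continuous|exact: cvg_id].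
  exact: continuous_exp_partial.
have dPhi (w : R) : is_derive w (1 : R) Phi (phi w).
  have dE : is_derive w (1 : R) (fun w => exp_partial a.+1 (y - w)) (- exp_partial a (y - w)).
    have d1 : is_derive w (1 : R) (fun w => y - w) (-1).
      apply: is_derive_eq (is_deriveB (is_derive_cst y w 1) (is_derive_id w 1)) _.
      by rewrite sub0r.
    have := @is_derive1_comp _ _ (fun w => y - w) w _ _ (is_derive_exp_partial a (y - w)) d1.
    by rewrite mulrN1.
  by apply: is_derive_eq; rewrite /phi /GRing.scale/=; ring.
have phi0 w : 0 <= w < y -> 0 <= phi w.
  move=> /andP[w0 wy]; rewrite -phiE// mulr_ge0 ?gamma_cdf_ge0//.
  by rewrite mulr_ge0 ?expR_ge0// invr_ge0 pi_ge0.
rewrite (integral_plane_radial y0 cphi dPhi phi0).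
congr (_%:E); rewrite /gamma_cdf leNgt y0/= /Phi subrr exp_partial_at0 subr0 oppr0 expR0.
have : (pi : R) != 0 by rewrite gt_eqF// pi_gt0.
by move: (pi) => p p0; field.
Qed.

Definition half_normal2 : probability RR R := (N \x N)%E.

Lemma half_normal2X (A B : set (measurableTypeR R)) :
  measurable A -> measurable B -> half_normal2 (A `*` B) = (N A * N B)%E.
Proof. by move=> mA mB; rewrite [LHS]product_measure1E. Qed.

Lemma half_normal2_rotation (c s : R) (S : set RR) :
  c ^+ 2 + s ^+ 2 = 1 -> measurable S ->
  half_normal2 [set z | S (c * z.1 - s * z.2, s * z.1 + c * z.2)%R] =
  half_normal2 S.
Proof. exact: rotation. Qed.

Lemma half_normal2_gamma_cdf a y :
  (\int[half_normal2]_z (gamma_cdf a (y - (z.1 ^+ 2 + z.2 ^+ 2)))%:E =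
   (gamma_cdf a.+1 y)%:E)%E.
Proof. exact: radial_gamma_cdf. Qed.

End gauss_plane.

(** * Families of conditionally i.i.d. Gaussian variables *)

Section law_on.
Context {d du : measure_display} {T : measurableType d} {U : measurableType du}.
Context {R : realType} (mu : {finite_measure set T -> \bar R}).
Variables (f : T -> U) (D : set T).

(* The measurability proofs only serve to make the measure structure below
   canonical. *)
Definition law_on (mf : measurable_fun setT f) (mD : measurable D)
  (A : set U) : \bar R := mu (D `&` f @^-1` A).

Hypotheses (mf : measurable_fun setT f) (mD : measurable D).

Let mpre A : measurable A -> measurable (f @^-1` A).
Proof. by move=> mA; rewrite -[_ @^-1` _]setTI; exact: mf. Qed.

Let law_on0 : law_on mf mD set0 = 0%E.
Proof. by rewrite /law_on preimage_set0 setI0 measure0. Qed.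

Let law_on_ge0 A : (0 <= law_on mf mD A)%E.
Proof. exact: measure_ge0. Qed.

Let law_on_sigma_additive : semi_sigma_additive (law_on mf mD).
Proof.
move=> F mF tF mUF; rewrite /law_on preimage_bigcup setI_bigcupr.
apply: measure_semi_sigma_additive.
- by move=> n; apply: measurableI => //; exact: mpre.
- apply/trivIsetP => /= i j _ _ ij; rewrite setIACA setIid -preimage_setI.
  by move/trivIsetP : tF => /(_ _ _ _ _ ij) ->//; rewrite preimage_set0 setI0.
- rewrite -setI_bigcupr -preimage_bigcup; apply: measurableI => //.
  exact: mpre.
Qed.

HB.instance Definition _ := isMeasure.Build _ _ _ (law_on mf mD)
  law_on0 law_on_ge0 law_on_sigma_additive.

Let law_on_fin : fin_num_fun (law_on mf mD).
Proof.
move=> A mA; apply: fin_num_measure; apply: measurableI => //; exact: mpre.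
Qed.

HB.instance Definition _ := Measure_isFinite.Build _ _ _ (law_on mf mD) law_on_fin.

End law_on.

Section product_scale.
Context {d1 d2 : measure_display} {T1 : measurableType d1} {T2 : measurableType d2}.
Context {R : realType}.
Variables (m1 : {finite_measure set T1 -> \bar R}).
Variables (m2 : {sigma_finite_measure set T2 -> \bar R}).

Lemma product_measure_scale (k : {nonneg R}) (S : set (T1 * T2)) : measurable S ->
  ((mscale k m1 \x m2) S = k%:num%:E * (m1 \x m2) S)%E.
Proof.
move=> mS.
rewrite (@product_measure_unique _ _ _ _ _ _ _ (mscale k (m1 \x m2)%E))//.
move=> A B mA mB; rewrite -[LHS]/(k%:num%:E * (m1 \x m2) (A `*` B))%E.
by rewrite product_measure1E// muleA.
Qed.

End product_scale.

Section pair_law.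
Context {d du : measure_display} {T : measurableType d} {U : measurableType du}.
Context {R : realType} (mu : {finite_measure set T -> \bar R}).
Local Notation N := (@half_normal R).
Local Notation N2 := (@half_normal2 R).
Variables (Y : T -> U) (V1 V2 : T -> measurableTypeR R) (D : set T).
Hypotheses (mY : measurable_fun setT Y) (mV1 : measurable_fun setT V1).
Hypotheses (mV2 : measurable_fun setT V2) (mD : measurable D).

(** Uniqueness of product measures is used twice: for fixed [A] it passes from rectangles [B1 x B2]
    to all planar sets [C], with [k] the mass of the event on [Y]; then from the sets [A x C] to all
    [S]. *)
Lemma law_on_pair (S : set (U * (measurableTypeR R * measurableTypeR R))) :
  (forall A B1 B2, measurable A -> measurable B1 -> measurable B2 ->
    mu (D `&` [set w | [/\ A (Y w), B1 (V1 w) & B2 (V2 w)]]) =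
    mu (D `&` Y @^-1` A) * (N B1 * N B2))%E ->
  measurable S ->
  (mu (D `&` [set w | S (Y w, (V1 w, V2 w))]) =
   (law_on mu mY mD \x N2) S)%E.
Proof.
move=> H mS.
have mV : measurable_fun setT (fun w => (V1 w, V2 w)) by exact: measurable_fun_pair.
have mYV : measurable_fun setT (fun w => (Y w, (V1 w, V2 w))).
  exact: measurable_fun_pair.
transitivity (law_on mu mYV mD S); first by [].
apply/esym; apply: product_measure_unique => //.
move=> A C mA mC.
have mDA : measurable (D `&` Y @^-1` A).
  by apply: measurableI => //; rewrite -[_ @^-1` _]setTI; exact: mY.
have k0 : 0 <= fine (mu (D `&` Y @^-1` A)) by exact: fine_ge0.
pose k := NngNum k0.
have kE : k%:num%:E = mu (D `&` Y @^-1` A) by rewrite /= fineK// fin_num_measure.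
transitivity (k%:num%:E * (N \x N) C)%E; last by rewrite kE.
rewrite -product_measure_scale//.
transitivity (law_on mu mV mDA C).
  by rewrite /law_on; congr (mu _); apply/seteqP; split => w /=; tauto.
apply/esym; apply: product_measure_unique => //.
move=> B1 B2 mB1 mB2; rewrite /law_on /mscale/= -muleA kE -H//.
by congr (mu _); apply/seteqP; split => w /=; [case=> -[? ?] [? ?]|case=> ? [? ? ?]].
Qed.

End pair_law.

Section gauss_given.
Context {d du : measure_display} {T : measurableType d} {U : measurableType du}.
Context {R : realType} {J : finType}.
Local Notation N := (@half_normal R).
Local Notation N2 := (@half_normal2 R).
Local Open Scope ereal_scope.

(* Given Y, the variables X j for j in K are i.i.d. of law N(0, 1/2). *)
Definition gauss_given (mu : set T -> \bar R) (Y : T -> U)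
    (X : J -> T -> R) (K : {set J}) : Prop :=
  [/\ measurable_fun setT Y, forall j, measurable_fun setT (X j) &
  forall A (B : J -> set R), measurable A -> (forall j, measurable (B j)) ->
  mu [set w | A (Y w) /\ forall j, j \in K -> B j (X j w)] =
  mu (Y @^-1` A) * \big[*%E/1]_(j in K) N (B j)].

Lemma gauss_given_ext (mu : set T -> \bar R) Y (X X' : J -> T -> R) (K : {set J}) :
  (forall j, measurable_fun setT (X' j)) ->
  (forall j, j \in K -> X j = X' j) ->
  gauss_given mu Y X K -> gauss_given mu Y X' K.
Proof.
move=> mX' XX' [mY mX H]; split => // A B mA mB; rewrite -H//.
congr (mu _); apply/seteqP; split => w /= [? h]; split => // j jK.
  by rewrite XX'//; exact: h.
by rewrite -XX'//; exact: h.
Qed.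

Lemma measurable_forall (X : J -> T -> R) (K : {set J}) (B : J -> set R) :
  (forall j, measurable_fun setT (X j)) -> (forall j, measurable (B j)) ->
  measurable [set w | forall j, j \in K -> B j (X j w)].
Proof.
move=> mX mB.
rewrite (_ : [set w | _] = \bigcap_(j in [set` K]) (X j @^-1` B j)); last first.
  by apply/seteqP; split.
apply: fin_bigcap_measurable; first exact: finite_finset.
by move=> j _; rewrite -[_ @^-1` _]setTI; exact: mX.
Qed.

End gauss_given.

Section gauss_given_pair.
Context {d du : measure_display} {T : measurableType d} {U : measurableType du}.
Context {R : realType} {J : finType}.
Local Notation N := (@half_normal R).
Local Notation N2 := (@half_normal2 R).
Local Open Scope ereal_scope.

Variables (mu : {finite_measure set T -> \bar R}) (Y : T -> U) (X : J -> T -> R).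
Variables (K : {set J}) (p q : J).
Hypotheses (pq : p != q) (pK : p \in K) (qK : q \in K).
Hypothesis HX : gauss_given mu Y X K.
Local Notation K' := (K :\ p :\ q).
Let mY : measurable_fun setT Y. Proof. by case: HX. Qed.
Let mX j : measurable_fun setT (X j). Proof. by case: HX. Qed.
Local Notation lawY := (law_on mu mY measurableT).

Let prodN_ge0 (L : {set J}) (B : J -> set R) : 0 <= \big[*%E/1]_(j in L) N (B j).
Proof. by apply: (big_ind (fun x => 0 <= x)) => // x y x0 y0; exact: mule_ge0. Qed.

Let prodN_fin (L : {set J}) (B : J -> set R) : (forall j, measurable (B j)) ->
  \big[*%E/1]_(j in L) N (B j) \is a fin_num.
Proof.
move=> mB; apply: (big_ind (fun x => x \is a fin_num)) => // [x y ? ?|j _].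
  exact: fin_numM.
exact: (fin_num_measure N (B j) (mB j)).
Qed.

(** The constraints on the other coordinates form the event [E], on which [law_on_pair] applies.
    Rectangles in [(Y, X p, X q)] are thereby upgraded to arbitrary measurable sets, with the other
    coordinates still factored out. *)
Lemma gauss_given_pair (S : set (U * (measurableTypeR R * measurableTypeR R)))
    (B : J -> set R) :
  measurable S -> (forall j, measurable (B j)) ->
  mu [set w | S (Y w, (X p w, X q w)) /\ forall j, j \in K' -> B j (X j w)] =
  (lawY \x N2) S * \big[*%E/1]_(j in K') N (B j).
Proof.
move=> mS mB; have [_ _ H] := HX.
pose E := [set w | forall j, j \in K' -> B j (X j w)].
have mE : measurable E by exact: measurable_forall.
have prodE (B1 B2 : set R) : \big[*%E/1]_(j in K)
    N (if j == p then B1 else if j == q then B2 else B j) =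
    N B1 * N B2 * \big[*%E/1]_(j in K') N (B j).
  rewrite (big_setD1 p)//= eqxx (big_setD1 q)/=; last first.
    by rewrite !inE eq_sym pq.
  rewrite (eq_sym q) (negPf pq) eqxx muleA; congr (_ * _).
  by apply: eq_bigr => j; rewrite !inE => /and3P[/negPf -> /negPf -> _].
have mB' (B1 B2 : set R) j : measurable B1 -> measurable B2 ->
    measurable (if j == p then B1 else if j == q then B2 else B j).
  by move=> ? ?; case: ifP => // _; case: ifP.
have evE (A : set U) (B1 B2 : set R) :
    E `&` [set w | [/\ A (Y w), B1 (X p w) & B2 (X q w)]] =
    [set w | A (Y w) /\ forall j, j \in K ->
      (if j == p then B1 else if j == q then B2 else B j) (X j w)].
  apply/seteqP; split => w /=.
    move=> [h [Aw B1w B2w]]; split => // j jK.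
    have [->//|jp] := eqVneq j p; have [->//|jq] := eqVneq j q.
    by apply: h; rewrite !inE jp jq.
  move=> [Aw h]; split.
    move=> j; rewrite !inE => /and3P[jq jp jK].
    by have := h j jK; rewrite (negPf jp) (negPf jq).
  split => //; first by have := h p pK; rewrite eqxx.
  by have := h q qK; rewrite eq_sym (negPf pq) eqxx.
have EA (A : set U) : measurable A ->
    mu (E `&` Y @^-1` A) = mu (Y @^-1` A) * \big[*%E/1]_(j in K') N (B j).
  move=> mA; have := H A _ mA (fun j => mB' setT setT j measurableT measurableT).
  rewrite prodE -evE !probability_setT !mul1e => <-.
  by congr (mu _); apply/seteqP; split => w /= [? h]; split => //; case: h.
have -> : [set w | S (Y w, (X p w, X q w)) /\ forall j, j \in K' -> B j (X j w)] =
    E `&` [set w | S (Y w, (X p w, X q w))].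
  by apply/seteqP; split => w /= [].
rewrite (@law_on_pair _ _ _ _ _ mu Y (X p) (X q) E mY (mX p) (mX q) mE)//; last first.
  move=> A B1 B2 mA mB1 mB2; rewrite evE.
  rewrite (H A _ mA (fun j => mB' B1 B2 j mB1 mB2)).
  by rewrite prodE EA// -!muleA; congr (_ * _); rewrite muleA muleC.
have c0 : (0 <= fine (\big[*%E/1]_(j in K') N (B j))%E)%R by exact: fine_ge0.
pose c := NngNum c0.
have cE : c%:num%:E = \big[*%E/1]_(j in K') N (B j) by rewrite /= fineK// prodN_fin.
rewrite -cE muleC -product_measure_scale//.
apply/esym; apply: product_measure_unique => // A C mA mC.
rewrite [LHS]product_measure1E//; congr (_ * _).
transitivity (mu (E `&` Y @^-1` A)); first by [].
transitivity (c%:num%:E * mu (setT `&` Y @^-1` A)); last by [].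
by rewrite EA// setTI cE muleC.
Qed.

Lemma gauss_given_pairT (S : set (U * (measurableTypeR R * measurableTypeR R))) :
  measurable S ->
  mu [set w | S (Y w, (X p w, X q w))] = (lawY \x N2) S.
Proof.
move=> mS; have := @gauss_given_pair S (fun=> setT) mS (fun=> measurableT).
rewrite big1 ?mule1 => [<-|j _]; last exact: probability_setT.
by congr (mu _); apply/seteqP; split => w //= [].
Qed.

(** Moves a pair from the Gaussian family into the conditioning data, so that later rotation angles
    may depend on it. *)
Lemma gauss_given_absorb :
  gauss_given mu (fun w => (Y w, (X p w, X q w))) X K'.
Proof.
split => //.
  by apply: measurable_fun_pair => //; apply: measurable_fun_pair; exact: mX.
move=> S B mS mB; rewrite gauss_given_pair//; congr (_ * _).
by rewrite -gauss_given_pairT.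
Qed.

(** The angle may be random as long as it is a function of [Y]: for each fixed value [u] the pair
    has the planar Gaussian law, which the rotation of angle [(c u, s u)] preserves. It remains to
    integrate over [u] in [A]. *)
Lemma gauss_given_rotate (c s : U -> R) :
  measurable_fun setT c -> measurable_fun setT s ->
  (forall u, c u ^+ 2 + s u ^+ 2 = 1)%R ->
  gauss_given mu Y (fun j w =>
    if j == p then c (Y w) * X p w - s (Y w) * X q w
    else if j == q then s (Y w) * X p w + c (Y w) * X q w
    else X j w)%R K.
Proof.
move=> mc ms cs1.
have mcY : measurable_fun setT (c \o Y) by exact: measurableT_comp.
have msY : measurable_fun setT (s \o Y) by exact: measurableT_comp.
split => //.
  move=> j; case: eqVneq => _.
    by apply: measurable_funB; apply: measurable_funM.
  case: eqVneq => _ //.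
  by apply: measurable_funD; apply: measurable_funM.
move=> A B mA mB.
pose rot (z : U * (measurableTypeR R * measurableTypeR R)) :
    measurableTypeR R * measurableTypeR R :=
  (c z.1 * z.2.1 - s z.1 * z.2.2, s z.1 * z.2.1 + c z.1 * z.2.2)%R.
have mrot : measurable_fun setT rot.
  have m1 : measurable_fun setT
    (fun z : U * (measurableTypeR R * measurableTypeR R) => z.2.1).
    exact: (measurableT_comp measurable_fst measurable_snd).
  have m2 : measurable_fun setT
    (fun z : U * (measurableTypeR R * measurableTypeR R) => z.2.2).
    exact: (measurableT_comp measurable_snd measurable_snd).
  have mc1 : measurable_fun setT
    (fun z : U * (measurableTypeR R * measurableTypeR R) => c z.1).
    exact: (measurableT_comp mc measurable_fst).
  have ms1 : measurable_fun setT
    (fun z : U * (measurableTypeR R * measurableTypeR R) => s z.1).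
    exact: (measurableT_comp ms measurable_fst).
  apply: measurable_fun_pair.
    by apply: measurable_funB; apply: measurable_funM.
  by apply: measurable_funD; apply: measurable_funM.
pose S := fst @^-1` A `&` rot @^-1` (B p `*` B q).
have mS : measurable S.
  apply: measurableI; first by rewrite -[_ @^-1` _]setTI; exact: measurable_fst.
  by rewrite -[_ @^-1` _]setTI; apply: mrot; [exact: measurableT|exact: (measurableX (mB p) (mB q))].
rewrite [X in mu X = _](_ : _ = [set w | S (Y w, (X p w, X q w)) /\
    forall j, j \in K' -> B j (X j w)]); last first.
  apply/seteqP; split => w /=; rewrite /S /rot/=.
    move=> [Aw h]; split; first split=> //.
      split; first by have := h p pK; rewrite eqxx.
      by have := h q qK; rewrite eqxx eq_sym (negPf pq).
    move=> j; rewrite !inE => /and3P[jq jp jK].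
    by have := h j jK; rewrite (negPf jp) (negPf jq).
  move=> [[Aw [hp hq]] h]; split => // j jK.
  have [->//|jp] := eqVneq j p; have [->//|jq] := eqVneq j q.
  by apply: h; rewrite !inE jp jq.
rewrite gauss_given_pair//.
rewrite [X in _ = _ * X](big_setD1 p)//= [X in _ = _ * (_ * X)](big_setD1 q)/=; last first.
  by rewrite !inE eq_sym pq.
rewrite !muleA; congr (_ * _).
have -> : mu (Y @^-1` A) = lawY A by rewrite /law_on setTI.
rewrite /product_measure1 -muleA.
transitivity (\int[lawY]_(u in A) (N (B p) * N (B q))).
  rewrite [RHS]integral_mkcond; apply: eq_integral => u _ /=; rewrite patchE.
  (* The section of [S] at [u] is the preimage of the rectangle under one fixed rotation if [u] lies
     in [A], and is empty otherwise. *)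
  case: ifPn => [|]; rewrite ?inE ?notin_setE => Au.
    transitivity (N2 [set z | (B p `*` B q)
        (c u * z.1 - s u * z.2, s u * z.1 + c u * z.2)%R]).
      by congr (N2 _); apply/seteqP; split => z; rewrite /xsection/= inE// => -[].
    rewrite half_normal2_rotation//; last exact: (measurableX (mB p) (mB q)).
    exact: (half_normal2X (mB p) (mB q)).
  have -> : xsection S u = set0.
    by apply/seteqP; split => z //; rewrite /xsection/= inE => -[].
  exact: (measure0 N2).
by rewrite integral_cst// muleC.
Qed.

End gauss_given_pair.

Section gauss_given_operations.
Context {d du : measure_display} {T : measurableType d} {U : measurableType du}.
Context {R : realType} {J : finType}.
Variables (mu : {finite_measure set T -> \bar R}) (X : J -> T -> R) (K : {set J}).

Lemma gauss_given_comp {du' : measure_display} {U' : measurableType du'}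
    (Y : T -> U) (h : U -> U') : measurable_fun setT h ->
  gauss_given mu Y X K -> gauss_given mu (h \o Y) X K.
Proof.
move=> mh [mY mX H]; split => //; first exact: measurableT_comp.
move=> A B mA mB; apply: (H (h @^-1` A)) => //.
by rewrite -[_ @^-1` _]setTI; exact: mh.
Qed.

(** This is how the induction conditions on the bound for [|u_l|^2]. The restricted measure is not
    normalised, whence the finite measures instead of probabilities. *)
Lemma gauss_given_restrict (Y : T -> U) (A : set U)
    (mD : measurable (Y @^-1` A)) : measurable A ->
  gauss_given mu Y X K ->
  gauss_given (law_on mu (@measurable_id _ T setT) mD) Y X K.
Proof.
move=> mA [mY mX H]; split => // A' B mA' mB; rewrite /law_on !preimage_id.
rewrite -preimage_setI -H//; last exact: measurableI.
by congr (mu _); apply/seteqP; split => w /=; [case=> ? []|case=> -[? ?] ?].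
Qed.

End gauss_given_operations.

Section gamma_given.
Context {d : measure_display} {T : measurableType d}.
Context {R : realType} {J : finType}.
Local Notation N2 := (@half_normal2 R).
Local Open Scope ereal_scope.

(** [Y] has two roles: it is the running sum of exponential variables whose law is tracked, and the
    variable of which the coordinates in [K] are independent. The factor [mu setT] accounts for
    measures already restricted to earlier events. *)
Definition gamma_given (mu : set T -> \bar R) (Y : T -> measurableTypeR R)
    (X : J -> T -> R) (K : {set J}) (a : nat) : Prop :=
  gauss_given mu Y X K /\
  forall y : R, mu [set w | (Y w < y)%R] = mu setT * (gamma_cdf a y)%:E.

Lemma gamma_given_add (mu : {finite_measure set T -> \bar R}) Y X
    (K : {set J}) a (p q : J) :
  p != q -> p \in K -> q \in K -> gamma_given mu Y X K a ->
  gamma_given mu (fun w => Y w + (X p w ^+ 2 + X q w ^+ 2))%R X (K :\ p :\ q) a.+1.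
Proof.
move=> pq pK qK [HX HY]; have [mY mX _] := HX.
pose h (z : measurableTypeR R * (measurableTypeR R * measurableTypeR R)) :
  measurableTypeR R := (z.1 + (z.2.1 ^+ 2 + z.2.2 ^+ 2))%R.
have mq : measurable_fun setT
    (fun z : measurableTypeR R * measurableTypeR R => (z.1 ^+ 2 + z.2 ^+ 2)%R).
  by apply: measurable_funD; apply: measurable_funX.
have mh : measurable_fun setT h.
  by apply: measurable_funD => //; exact: (measurableT_comp mq measurable_snd).
split; first exact: (gauss_given_comp mh (gauss_given_absorb pq pK qK HX)).
move=> y; pose S := h @^-1` `]-oo, y[%classic.
have mS : measurable S.
  by rewrite /S -[_ @^-1` _]setTI; apply: mh => //; exact: measurable_itv.
have := gauss_given_pairT pq pK qK HX mS; rewrite -/S => E.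
transitivity (mu [set w | S (Y w, (X p w, X q w))]).
  by congr (mu _); apply/seteqP; split => w /=; rewrite in_itv.
rewrite {}E.
set lawY := law_on mu _ _.
(* The pair is integrated last: for a fixed value [z] of it, the inner event is [Y < y - |z|^2],
   whose mass [gamma_cdf a] gives. *)
transitivity ((lawY \x^ N2) S).
  by apply: product_measure_unique => // A C mA mC; exact: product_measure2E.
rewrite /product_measure2.
transitivity (\int[N2]_z (mu setT * (gamma_cdf a (y - (z.1 ^+ 2 + z.2 ^+ 2)))%:E)).
  apply: eq_integral => z _ /=; rewrite -HY /lawY /law_on setTI; congr (mu _).
  by apply/seteqP; split => w /=; rewrite /ysection/= inE /S /h/= in_itv/= ltrBrDr.
rewrite ge0_integralZl//.
- by rewrite half_normal2_gamma_cdf.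
- apply/measurable_EFinP; apply: measurableT_comp; first exact: measurable_gamma_cdf.
  by apply: measurable_funB.
- by move=> z _; rewrite lee_fin gamma_cdf_ge0.
Qed.

Lemma gamma_given_zero (mu : {finite_measure set T -> \bar R}) (X : J -> T -> R) K :
  gauss_given mu (fun=> 0%R : measurableTypeR R) X K ->
  gamma_given mu (fun=> 0%R) X K 0.
Proof.
move=> H; split => // y; rewrite gamma_cdf0.
case: ltP => y0.
  by rewrite mule1; congr (mu _); apply/seteqP; split.
rewrite mule0 (_ : [set w | _] = set0) ?measure0//.
by apply/seteqP; split => w //=; rewrite ltNge y0.
Qed.

End gamma_given.

Section slot_rotation.
Context {d du : measure_display} {T : measurableType d} {U : measurableType du}.
Context {R : realType} {I S : finType}.

(** A slot stands for a real coordinate within a row. The same angle is applied in every row, as in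
    a multiplication of the matrix on the right. *)
Definition slot_rot (u v : S) (c s : T -> R) (X : I * S -> T -> R) :
    I * S -> T -> R := fun j w =>
  if j.2 == u then c w * X (j.1, u) w - s w * X (j.1, v) w
  else if j.2 == v then s w * X (j.1, u) w + c w * X (j.1, v) w
  else X j w.

(** Rows are rotated one at a time; in [Z r] those of [r] are done. By the hypothesis on [K], a row
    has both slots in [K], and [gauss_given_rotate] applies, or neither, and the product formula
    does not see the change. *)
Lemma gauss_given_slot_rot (mu : {finite_measure set T -> \bar R}) (Y : T -> U)
    (X : I * S -> T -> R) (K : {set I * S}) (u v : S) (c s : U -> R) :
  u != v -> (forall i, ((i, u) \in K) = ((i, v) \in K)) ->
  measurable_fun setT c -> measurable_fun setT s ->
  (forall y, c y ^+ 2 + s y ^+ 2 = 1) ->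
  gauss_given mu Y X K ->
  gauss_given mu Y (slot_rot u v (c \o Y) (s \o Y) X) K.
Proof.
move=> uv Kuv mc ms cs1 HX; have [mY mX _] := HX.
have mcY : measurable_fun setT (c \o Y) by exact: measurableT_comp.
have msY : measurable_fun setT (s \o Y) by exact: measurableT_comp.
have mrot j : measurable_fun setT (slot_rot u v (c \o Y) (s \o Y) X j).
  rewrite /slot_rot; case: eqVneq => _.
    by apply: measurable_funB; apply: measurable_funM.
  case: eqVneq => _ //.
  by apply: measurable_funD; apply: measurable_funM.
pose Z (r : seq I) (j : I * S) :=
  if j.1 \in r then slot_rot u v (c \o Y) (s \o Y) X j else X j.
have mZ r j : measurable_fun setT (Z r j) by rewrite /Z; case: ifP.
suff HZ r : gauss_given mu Y (Z r) K.
  apply: gauss_given_ext (HZ (enum I)) => // j _.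
  by rewrite /Z mem_enum.
elim: r => [|i r IH]; first exact: gauss_given_ext HX.
have [ir|ir] := boolP (i \in r).
  apply: gauss_given_ext IH => // j _; rewrite /Z inE.
  by case: eqVneq => //= ->; rewrite ir.
have [iK|iK] := boolP ((i, u) \in K); last first.
  apply: gauss_given_ext IH => // -[i' t] jK; rewrite /Z inE/=.
  case: eqVneq => //= ii'; rewrite ii' (negPf ir).
  apply/funext => w; rewrite /slot_rot/=.
  case: eqVneq => tu; first by rewrite -ii' -tu jK in iK.
  by case: eqVneq => tv //; rewrite Kuv -ii' -tv jK in iK.
have iv : (i, v) \in K by rewrite -Kuv.
have piq : (i, u) != (i, v) by rewrite xpair_eqE eqxx.
apply: gauss_given_ext (gauss_given_rotate piq iK iv IH mc ms cs1) => //.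
move=> [i' t] _; apply/funext => w; rewrite /Z !inE/= !xpair_eqE.
case: eqVneq => [->|_]//=.
by rewrite (negPf ir) /slot_rot/=; case: eqVneq => [//|_]; case: eqVneq.
Qed.

End slot_rotation.

(** * Determinants of shifted Gram matrices *)

Section complex_gram.
Context {R : rcfType}.
Local Notation C := R[i].
Local Open Scope complex_scope.

Lemma ctrmx_mul p q r (A : 'M[C]_(p, q)) (B : 'M[C]_(q, r)) :
  ctrmx (A *m B) = ctrmx B *m ctrmx A.
Proof. by rewrite /ctrmx trmx_mul map_mxM. Qed.

Lemma ctrmxK p q (A : 'M[C]_(p, q)) : ctrmx (ctrmx A) = A.
Proof. by apply/matrixP => i j; rewrite !mxE conjcK. Qed.

Lemma ctrmxD p q (A B : 'M[C]_(p, q)) : ctrmx (A + B) = ctrmx A + ctrmx B.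
Proof. by apply/matrixP => i j; rewrite !mxE rmorphD. Qed.

Lemma ctrmxZ p q (c : R) (A : 'M[C]_(p, q)) : ctrmx (c%:C *: A) = c%:C *: ctrmx A.
Proof.
by apply/matrixP => i j; rewrite !mxE rmorphM/=; congr (_ * _); rewrite oppr0.
Qed.

Lemma ctrmx1 p : ctrmx (1%:M : 'M[C]_p) = 1%:M.
Proof.
apply/matrixP => i j; rewrite !mxE eq_sym.
by case: (i == j); rewrite ?mulr1n ?mulr0n ?rmorph1 ?rmorph0.
Qed.

Definition sqabs (z : C) : R := complex.Re z ^+ 2 + complex.Im z ^+ 2.

Definition sqnorm p q (A : 'M[C]_(p, q)) : R := \sum_i \sum_j sqabs (A i j).

Lemma sqabs_ge0 z : 0 <= sqabs z.
Proof. by rewrite addr_ge0 ?sqr_ge0. Qed.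

Lemma mul_conjc_sqabs (z : C) : z * z^* = (sqabs z)%:C.
Proof. by case: z => a b; rewrite /sqabs; simpc; congr (_ +i* _); ring. Qed.

Lemma sqabs_eq0 z : (sqabs z == 0) = (z == 0).
Proof.
case: z => a b; rewrite /sqabs/= paddr_eq0 ?sqr_ge0// !sqrf_eq0.
by rewrite eq_complex.
Qed.

Lemma sqnorm_ge0 p q (A : 'M[C]_(p, q)) : 0 <= sqnorm A.
Proof. by apply: sumr_ge0 => i _; apply: sumr_ge0 => j _; exact: sqabs_ge0. Qed.

Lemma sqnorm_eq0 p q (A : 'M[C]_(p, q)) : sqnorm A = 0 -> A = 0.
Proof.
move=> /eqP; rewrite psumr_eq0; last first.
  by move=> i _; apply: sumr_ge0 => j _; exact: sqabs_ge0.
move=> /allP h; apply/matrixP => i j; rewrite mxE; apply/eqP.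
have := h i (mem_index_enum i); rewrite psumr_eq0; last by move=> *; exact: sqabs_ge0.
by move=> /allP /(_ j (mem_index_enum j)); rewrite /= sqabs_eq0.
Qed.

Lemma mul_ctrmx_row q (x : 'rV[C]_q) : (x *m ctrmx x) 0 0 = (sqnorm x)%:C.
Proof.
rewrite mxE /sqnorm big_ord1 rmorph_sum/=; apply: eq_bigr => j _.
by rewrite !mxE mul_conjc_sqabs.
Qed.

Lemma mul_ctrmx_col p (u : 'cV[C]_p) : (ctrmx u *m u) 0 0 = (sqnorm u)%:C.
Proof.
rewrite mxE /sqnorm rmorph_sum/=; apply: eq_bigr => j _.
by rewrite big_ord1 !mxE mulrC mul_conjc_sqabs.
Qed.

(** [L] intertwines two block triangular matrices, one with [1 + x v] on its diagonal and one with
    [1 + v x]; as [det L = 1], their determinants agree. *)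
Lemma det_1D_rank1 p (x : 'cV[C]_p) (v : 'rV[C]_p) :
  \det (1%:M + x *m v) = 1 + (v *m x) 0 0.
Proof.
pose L := block_mx (1%:M : 'M[C]_1) 0 x (1%:M : 'M[C]_p).
have dL : \det L = 1 by rewrite det_lblock !det1 mulr1.
have E : L *m block_mx 1%:M (- v) 0 (1%:M + x *m v) =
         block_mx (1%:M + v *m x) (- v) 0 1%:M *m L.
  rewrite !mulmx_block !mul1mx !mulmx1 !mul0mx !mulmx0 !addr0 !add0r.
  by rewrite mulmxN mulNmx addrK [1%:M + _]addrC addKr.
have := congr1 determinant E; rewrite !det_mulmx dL mul1r mulr1.
rewrite !det_ublock !det1 mul1r mulr1 => ->.
by rewrite det_mx11 !mxE/= mulr1n.
Qed.

Lemma det_addr_rank1 p (A : 'M[C]_p) (u : 'cV[C]_p) (v : 'rV[C]_p) :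
  A \in unitmx ->
  \det (A + u *m v) = \det A * (1 + (v *m invmx A *m u) 0 0).
Proof.
move=> uA; rewrite -[v *m _ *m _]mulmxA -det_1D_rank1 -det_mulmx.
by rewrite mulmxDr mulmx1 !mulmxA mulmxV// mul1mx.
Qed.

Variable c : R.
Hypothesis c0 : 0 <= c.

Definition shifted_gram p q (B : 'M[C]_(p, q)) : 'M[C]_p :=
  1%:M + c%:C *: (B *m ctrmx B).

Lemma ctrmx_shifted_gram p q (B : 'M[C]_(p, q)) :
  ctrmx (shifted_gram B) = shifted_gram B.
Proof. by rewrite /shifted_gram ctrmxD ctrmx1 ctrmxZ ctrmx_mul ctrmxK. Qed.

Lemma shifted_gram_form p q (B : 'M[C]_(p, q)) (x : 'rV[C]_p) :
  (x *m shifted_gram B *m ctrmx x) 0 0 = (sqnorm x + c * sqnorm (x *m B))%:C.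
Proof.
rewrite /shifted_gram mulmxDr mulmx1 mulmxDl mxE mul_ctrmx_row -scalemxAr -scalemxAl.
have -> : x *m (B *m ctrmx B) *m ctrmx x = (x *m B) *m ctrmx (x *m B).
  by rewrite ctrmx_mul !mulmxA.
by rewrite mxE mul_ctrmx_row rmorphD rmorphM.
Qed.

(** Expanding [x A = x + c y] with [y = x B B^H], the right side exceeds the left by
    [c |x B|^2 + c^2 |y|^2]. *)
Lemma sqnorm_mul_shifted_gram p q (B : 'M[C]_(p, q)) (x : 'rV[C]_p) :
  sqnorm x + c * sqnorm (x *m B) <= sqnorm (x *m shifted_gram B).
Proof.
pose y := x *m B *m ctrmx B.
have xy : (x *m ctrmx y) 0 0 = (sqnorm (x *m B))%:C.
  by rewrite /y ctrmx_mul ctrmxK mulmxA mul_ctrmx_row.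
have yx : (y *m ctrmx x) 0 0 = (sqnorm (x *m B))%:C.
  by rewrite /y -mulmxA -ctrmx_mul mul_ctrmx_row.
have -> : sqnorm (x *m shifted_gram B) =
    sqnorm x + c * sqnorm (x *m B) + (c * sqnorm (x *m B) + c ^+ 2 * sqnorm y).
  apply: (@complexI R); rewrite -mul_ctrmx_row.
  have -> : x *m shifted_gram B = x + c%:C *: y.
    by rewrite /shifted_gram mulmxDr mulmx1 -scalemxAr mulmxA.
  rewrite ctrmxD ctrmxZ mulmxDl !mulmxDr -!scalemxAl -!scalemxAr scalerA.
  move: xy yx (mul_ctrmx_row x) (mul_ctrmx_row y).
  set M1 := x *m ctrmx y; set M2 := y *m ctrmx x.
  set M3 := x *m ctrmx x; set M4 := y *m ctrmx y.
  move: M1 M2 M3 M4 => M1 M2 M3 M4 e1 e2 e3 e4; rewrite !mxE e1 e2 e3 e4.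
  rewrite -!rmorphM -!rmorphD/=; congr (_%:C).
by rewrite lerDl addr_ge0// mulr_ge0 ?sqnorm_ge0// exprn_ge0.
Qed.

(** A vector [x] in the left kernel would satisfy [|x|^2 + c |x B|^2 = 0]. *)
Lemma shifted_gram_unit p q (B : 'M[C]_(p, q)) : shifted_gram B \in unitmx.
Proof.
rewrite unitmxE unitfE; apply/negP => /det0P[x x0 xA0].
have := shifted_gram_form B x; rewrite xA0 mul0mx mxE => /esym /complexI E.
move/eqP: x0; apply; apply: sqnorm_eq0; apply/eqP.
rewrite eq_le sqnorm_ge0 andbT -[leRHS]E lerDl.
by rewrite mulr_ge0 ?sqnorm_ge0.
Qed.

(* The correction term [u^H A^-1 u] of the rank-one update is [x A x^H] for
   [x = u^H A^-1], whereas [|u|^2 = |x A|^2]; and [A^2 >= A]. *)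
Lemma det_shifted_gram_rank1 p q (B : 'M[C]_(p, q)) (u : 'cV[C]_p) :
  exists2 t, 0 <= t <= sqnorm u &
  \det (shifted_gram B + c%:C *: (u *m ctrmx u)) =
  \det (shifted_gram B) * (1 + c * t)%:C.
Proof.
have uA := shifted_gram_unit B.
pose x := ctrmx u *m invmx (shifted_gram B).
have xA : x *m shifted_gram B = ctrmx u by rewrite /x mulmxKV.
have uE : u = shifted_gram B *m ctrmx x.
  by rewrite -[LHS]ctrmxK -xA ctrmx_mul ctrmx_shifted_gram.
exists (sqnorm x + c * sqnorm (x *m B)).
  rewrite addr_ge0 ?mulr_ge0 ?sqnorm_ge0//=.
  apply: (le_trans (sqnorm_mul_shifted_gram B x)); rewrite xA.
  rewrite -lecR -mul_ctrmx_row -mul_ctrmx_col ctrmxK.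
  by [].
rewrite scalemxAr det_addr_rank1//; congr (_ * _).
rewrite -!scalemxAl -/x mxE [in x *m u]uE mulmxA shifted_gram_form.
by rewrite -[1 in LHS](rmorph1 (real_complex R)) -rmorphM -rmorphD.
Qed.

(** Each column of [B] is a rank-one update that multiplies the determinant by a real number
    [1 + c t >= 1], starting from the value 1 for a matrix without columns. *)
Lemma det_shifted_gram_gt0 p q (B : 'M[C]_(p, q)) :
  exists2 D : R, 0 < D & \det (shifted_gram B) = D%:C.
Proof.
elim: q B => [|q IH] B.
  exists 1 => //; rewrite /shifted_gram (_ : B *m _ = 0) ?scaler0 ?addr0 ?det1//.
  by apply/matrixP => i j; rewrite !mxE big_ord0.
move: B; rewrite -[q.+1]/(1 + q)%N => B.
have [D D0 DE] := IH (rsubmx B).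
have [t /andP[t0 _] tE] := det_shifted_gram_rank1 (rsubmx B) (lsubmx B).
exists (D * (1 + c * t)); first by rewrite mulr_gt0// ltr_pwDl// mulr_ge0.
rewrite rmorphM/= -DE -tE; congr (\det _).
rewrite /shifted_gram -addrA -scalerDr; congr (_ + _ *: _).
rewrite -{1 2}[B]hsubmxK addrC.
have -> : ctrmx (row_mx (lsubmx B) (rsubmx B)) =
    col_mx (ctrmx (lsubmx B)) (ctrmx (rsubmx B)).
  by rewrite /ctrmx tr_row_mx map_col_mx.
by rewrite mul_row_col.
Qed.

Lemma Re_det_shifted_gram_le p q q' (M : 'M[C]_(p, q')) (B : 'M[C]_(p, q))
    (u : 'cV[C]_p) :
  M *m ctrmx M = B *m ctrmx B + u *m ctrmx u ->
  complex.Re (\det (shifted_gram M)) <=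
  complex.Re (\det (shifted_gram B)) * (1 + c * sqnorm u).
Proof.
move=> E; have [D D0 DE] := det_shifted_gram_gt0 B.
have [t /andP[t0 tu] tE] := det_shifted_gram_rank1 B u.
have -> : shifted_gram M = shifted_gram B + c%:C *: (u *m ctrmx u).
  by rewrite /shifted_gram E scalerDr addrA.
rewrite tE DE -rmorphM/= ler_wpM2l ?(ltW D0)//.
by rewrite lerD2l ler_wpM2l.
Qed.

Lemma Re_det_shifted_gram_gt0 p q (B : 'M[C]_(p, q)) :
  0 < complex.Re (\det (shifted_gram B)).
Proof. by have [D D0 ->] := det_shifted_gram_gt0 B. Qed.

End complex_gram.

(** * Plane rotations that clear an entry, and invariance of the Gram matrix *)

Section unit_direction.
Context {R : realType}.
Implicit Types a b : R.

(* The rotation of angle (cos, sin) = (unit_c, unit_s) maps (a, b) to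
   (sqrt (a^2 + b^2), 0); powR makes measurability immediate. *)
Definition unit_c (z : measurableTypeR R * measurableTypeR R) : R :=
  if z.1 ^+ 2 + z.2 ^+ 2 == 0 then 1
  else z.1 * (z.1 ^+ 2 + z.2 ^+ 2) `^ (- 2^-1).

Definition unit_s (z : measurableTypeR R * measurableTypeR R) : R :=
  - (z.2 * (z.1 ^+ 2 + z.2 ^+ 2) `^ (- 2^-1)).

Let measurable_q : measurable_fun setT
  (fun z : measurableTypeR R * measurableTypeR R => z.1 ^+ 2 + z.2 ^+ 2).
Proof. by apply: measurable_funD; apply: measurable_funX. Qed.

Let measurable_p : measurable_fun setT
  (fun z : measurableTypeR R * measurableTypeR R =>
     (z.1 ^+ 2 + z.2 ^+ 2) `^ (- 2^-1)).
Proof. exact: (measurableT_comp (measurable_powR _) measurable_q). Qed.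

Lemma measurable_unit_c : measurable_fun setT unit_c.
Proof.
apply: measurable_fun_ifT => //; first exact: measurable_fun_eqr.
exact: measurable_funM.
Qed.

Lemma measurable_unit_s : measurable_fun setT unit_s.
Proof.
apply: measurableT_comp => //; exact: measurable_funM.
Qed.

Let powE (y : R) : 0 < y -> y `^ (- 2^-1) = (Num.sqrt y)^-1.
Proof. by move=> y0; rewrite powRN powR12_sqrt// ltW. Qed.

Let sq0 a b : a ^+ 2 + b ^+ 2 = 0 -> a = 0 /\ b = 0.
Proof.
move/eqP; rewrite paddr_eq0 ?sqr_ge0// !sqrf_eq0.
by move=> /andP[/eqP -> /eqP ->].
Qed.

Let sq_gt0 a b : a ^+ 2 + b ^+ 2 != 0 -> 0 < a ^+ 2 + b ^+ 2.
Proof. by move=> h; rewrite lt_neqAle eq_sym h addr_ge0 ?sqr_ge0. Qed.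

Lemma unit_cs1 z : unit_c z ^+ 2 + unit_s z ^+ 2 = 1.
Proof.
case: z => a b; rewrite /unit_c /unit_s/=; case: eqVneq => [/sq0[-> ->]|h].
  by rewrite mul0r oppr0 expr0n/= addr0 expr1n.
have h0 := sq_gt0 h.
rewrite powE// sqrrN !exprMn -mulrDl exprVn sqr_sqrtr ?ltW//.
by rewrite divff.
Qed.

Lemma unit_cs_norm a b :
  unit_c (a, b) * a - unit_s (a, b) * b = Num.sqrt (a ^+ 2 + b ^+ 2).
Proof.
rewrite /unit_c /unit_s/=; case: eqVneq => [h|h].
  by have [-> ->] := sq0 h; rewrite expr0n/= addr0 sqrtr0 !mulr0 subr0.
have h0 := sq_gt0 h.
have s0 : Num.sqrt (a ^+ 2 + b ^+ 2) != 0 by rewrite gt_eqF// sqrtr_gt0.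
rewrite powE//; apply: (mulIf s0); rewrite -expr2 sqr_sqrtr ?ltW//.
by field.
Qed.

Lemma unit_cs_zero a b : unit_s (a, b) * a + unit_c (a, b) * b = 0.
Proof.
rewrite /unit_c /unit_s/=; case: eqVneq => [h|h].
  by have [-> ->] := sq0 h; rewrite !mulr0 addr0.
by ring.
Qed.

End unit_direction.

Section gram_invariance.
Context {R : rcfType}.
Local Notation C := R[i].
Variables (m n : nat).

Lemma gram_phase (M M' : 'M[C]_(m, n)) (j : 'I_n) (z : C) : z * (z^*)%C = 1 ->
  (forall i k, k != j -> M' i k = M i k) -> (forall i, M' i j = z * M i j) ->
  M' *m ctrmx M' = M *m ctrmx M.
Proof.
move=> z1 Mk Mj; apply/matrixP => i k; rewrite !mxE.
apply: eq_bigr => l _; rewrite !mxE; case: (eqVneq l j) => [->|lj].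
  by rewrite !Mj rmorphM mulrACA z1 mul1r.
by rewrite !Mk.
Qed.

Lemma gram_rotation (M M' : 'M[C]_(m, n)) (j1 j2 : 'I_n) (c s : R) : j1 != j2 ->
  c ^+ 2 + s ^+ 2 = 1 ->
  (forall i k, k != j1 -> k != j2 -> M' i k = M i k) ->
  (forall i, M' i j1 = (c%:C * M i j1 - s%:C * M i j2)%C) ->
  (forall i, M' i j2 = (s%:C * M i j1 + c%:C * M i j2)%C) ->
  M' *m ctrmx M' = M *m ctrmx M.
Proof.
move=> j12 cs1 Mk M1 M2; apply/matrixP => i k; rewrite !mxE.
rewrite (bigD1 j1)//= [RHS](bigD1 j1)//=.
rewrite (bigD1 j2) 1?eq_sym//= [in RHS](bigD1 j2) 1?eq_sym//=.
rewrite !addrA; congr (_ + _); last first.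
  by apply: eq_bigr => l /andP[l1 l2]; rewrite !mxE !Mk.
rewrite !mxE !M1 !M2.
case: (M i j1) => a1 b1; case: (M i j2) => a2 b2.
case: (M k j1) => a3 b3; case: (M k j2) => a4 b4.
simpc; apply/eqP; rewrite eq_complex/=; apply/andP; split; apply/eqP.
  transitivity ((c ^+ 2 + s ^+ 2) * (a1 * a3 + b1 * b3 + a2 * a4 + b2 * b4)).
    by ring.
  by rewrite cs1; ring.
transitivity ((c ^+ 2 + s ^+ 2) * (b1 * a3 - a1 * b3 + (b2 * a4 - a2 * b4))).
  by ring.
by rewrite cs1; ring.
Qed.

End gram_invariance.

(** * Reduction of the random matrix *)

Section row_reduction.
Context {d : measure_display} {T : measurableType d} {R : realType} {m n : nat}.
Local Notation J := ('I_m * ('I_n * bool))%type.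
Local Notation C := R[i].
Implicit Types (X : J -> T -> R) (t : nat) (w : T).

Definition entry X (i : 'I_m) (j : 'I_n) w : C :=
  Complex (X (i, (j, true)) w) (X (i, (j, false)) w).

(* Zeroing rows and columns instead of deleting them keeps the matrix size
   constant along the induction. *)
Definition masked X s w : 'M[C]_(m, n) :=
  \matrix_(i, j) if (s <= i)%N && (s <= j)%N then entry X i j w else 0.

Definition gram X s w : 'M[C]_m := masked X s w *m ctrmx (masked X s w).

(** Multiplication of column [j] by the complex number [c + i s], seen as a rotation of its real and
    imaginary slots. *)
Definition phase_rot (j : 'I_n) (c s : T -> R) X : J -> T -> R :=
  slot_rot (j, true) (j, false) c s X.

(** A rotation of two complex columns with real coefficients, so that real and imaginary parts turn
    separately by the same angle. *)
Definition col_rot (j1 j2 : 'I_n) (c s : T -> R) X : J -> T -> R :=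
  slot_rot (j1, false) (j2, false) c s (slot_rot (j1, true) (j2, true) c s X).

Lemma entry_phase_rot j c s X i k w : entry (phase_rot j c s X) i k w =
  if k == j then Complex (c w) (s w) * entry X i j w else entry X i k w.
Proof.
rewrite /entry /phase_rot /slot_rot/= !xpair_eqE/= !andbT !andbF.
by case: eqVneq => // _; simpc; congr (_ +i* _)%C; ring.
Qed.

Lemma entry_col_rot j1 j2 c s X i k w :
  entry (col_rot j1 j2 c s X) i k w =
  if k == j1 then (c w)%:C%C * entry X i j1 w - (s w)%:C%C * entry X i j2 w
  else if k == j2 then (s w)%:C%C * entry X i j1 w + (c w)%:C%C * entry X i j2 w
  else entry X i k w.
Proof.
rewrite /entry /col_rot /slot_rot/= !xpair_eqE/= !andbT !andbF/=.
case: eqVneq => [_|_]; first by simpc.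
by case: eqVneq => [_|_] //; simpc.
Qed.

Lemma gram_phase_rot (j : 'I_n) c s X r w : (r <= j)%N ->
  c w ^+ 2 + s w ^+ 2 = 1 -> gram (phase_rot j c s X) r w = gram X r w.
Proof.
move=> rj cs1; apply: (@gram_phase _ _ _ _ _ j (Complex (c w) (s w))).
- simpc; apply/eqP; rewrite eq_complex/=; apply/andP; split; apply/eqP.
    by rewrite -cs1; ring.
  by ring.
- by move=> i k kj; rewrite !mxE entry_phase_rot (negPf kj).
- move=> i; rewrite !mxE entry_phase_rot eqxx rj andbT.
  by case: ifP => // _; rewrite mulr0.
Qed.

Lemma gram_col_rot (j1 j2 : 'I_n) c s X r w : j1 != j2 -> (r <= j1)%N ->
  (r <= j2)%N -> c w ^+ 2 + s w ^+ 2 = 1 ->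
  gram (col_rot j1 j2 c s X) r w = gram X r w.
Proof.
move=> j12 r1 r2 cs1; apply: (@gram_rotation _ _ _ _ _ j1 j2 (c w) (s w)) => //.
- by move=> i k k1 k2; rewrite !mxE entry_col_rot (negPf k1) (negPf k2).
- move=> i; rewrite !mxE entry_col_rot eqxx r1 r2 andbT.
  by case: ifP => // _; rewrite !mulr0 subr0.
- move=> i; rewrite !mxE entry_col_rot eqxx (eq_sym j2) (negPf j12) r1 r2 andbT.
  by case: ifP => // _; rewrite !mulr0 addr0.
Qed.

Definition box (s : nat) : {set J} := [set j : J | (s <= j.1)%N && (s <= j.2.1)%N].

(** What is still Gaussian while row [s] is being cleared: its entries in the unmasked columns
    before [t] have been absorbed into the conditioning variable. *)
Definition row_set (s t : nat) : {set J} := [set j : J |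
  ((s < j.1) && (s <= j.2.1) || (j.1 == s :> nat) && (t <= j.2.1))%N].

Section row_step.
Variables (mu : {finite_measure set T -> \bar R}) (X0 : J -> T -> R).
Variables (row : 'I_m) (col : 'I_n).
Hypothesis row_col : row = col :> nat.
Local Notation s := (nat_of_ord row).

(* After t steps, the row [row] of the masked matrix reads
   (sqrt Y, 0, .., 0, X row t, X row (t + 1), ..). *)
Definition row_state t X (Y : T -> measurableTypeR R) : Prop :=
  [/\ gamma_given mu Y X (row_set s t) (t - s),
      forall w, gram X s w = gram X0 s w,
      forall w, 0 <= Y w,
      t = s -> forall w, Y w = 0 &
      forall w (j : 'I_n), (s <= j < t)%N ->
        entry X row j w = if j == col then (Num.sqrt (Y w))%:C%C else 0].

(** A complex Givens step. The phase rotation replaces the entry of the pivot row in column [k] by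
    its modulus [r]; the rotation of columns [col] and [k] then sends [(sqrt Y, r)] to
    [(sqrt (Y + r^2), 0)]. Both angles depend on that entry, which is therefore first absorbed into
    [Y1]. *)
Lemma row_state_step (k : 'I_n) X Y : (s <= k)%N ->
  row_state k X Y -> exists X' Y', row_state k.+1 X' Y'.
Proof.
move=> sk [[G0 law0] gram0 Y0 Ys rowX].
pose p : J := (row, (k, true)); pose q : J := (row, (k, false)).
have pq : p != q by rewrite /p /q !xpair_eqE !eqxx.
have pK : p \in row_set s k by rewrite inE/= eqxx leqnn orbT.
have qK : q \in row_set s k by rewrite inE/= eqxx leqnn orbT.
have KE : row_set s k :\ p :\ q = row_set s k.+1.
  apply/setP => -[i [j b]]; rewrite !inE /p /q !xpair_eqE/=.
  rewrite -(inj_eq val_inj)/= -(inj_eq val_inj j)/=.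
  by case: b; rewrite ?andbT ?andbF/=; lia.
pose Y1 w : measurableTypeR R * (measurableTypeR R * measurableTypeR R) :=
  (Y w, (X p w, X q w)).
pose Y' w : measurableTypeR R := Y w + (X p w ^+ 2 + X q w ^+ 2).
have Y'0 w : 0 <= Y' w by rewrite addr_ge0// addr_ge0 ?sqr_ge0.
have [G' law'] := gamma_given_add pq pK qK (conj G0 law0).
rewrite -subSn// in law'.
have := gauss_given_absorb pq pK qK G0; rewrite KE -/Y1 => G1.
pose c1 (y : measurableTypeR R * (measurableTypeR R * measurableTypeR R)) :=
  unit_c y.2.
pose s1 (y : measurableTypeR R * (measurableTypeR R * measurableTypeR R)) :=
  unit_s y.2.
have mc1 : measurable_fun setT c1.
  exact: (measurableT_comp measurable_unit_c measurable_snd).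
have ms1 : measurable_fun setT s1.
  exact: (measurableT_comp measurable_unit_s measurable_snd).
have K1 i : ((i, (k, true)) \in row_set s k.+1) = ((i, (k, false)) \in row_set s k.+1).
  by rewrite !inE.
have kk : (k, true) != (k, false) by rewrite xpair_eqE andbF.
have G2 := gauss_given_slot_rot kk K1 mc1 ms1 (fun y => unit_cs1 y.2) G1.
rewrite -/(phase_rot _ _ _ _) in G2.
set X1 := phase_rot _ _ _ _ in G2.
have X1k w : entry X1 row k w = (Num.sqrt (X p w ^+ 2 + X q w ^+ 2))%:C%C.
  rewrite entry_phase_rot eqxx.
  transitivity (Complex
    (unit_c (X p w, X q w) * X p w - unit_s (X p w, X q w) * X q w)
    (unit_c (X p w, X q w) * X q w + unit_s (X p w, X q w) * X p w)); first by [].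
  by rewrite unit_cs_norm [unit_c _ * X q w + _]addrC unit_cs_zero.
have gram1 w : gram X1 s w = gram X0 s w.
  by rewrite gram_phase_rot//=; exact: unit_cs1.
pose h (y : measurableTypeR R * (measurableTypeR R * measurableTypeR R)) :
  measurableTypeR R := y.1 + (y.2.1 ^+ 2 + y.2.2 ^+ 2).
have mq : measurable_fun setT
    (fun z : measurableTypeR R * measurableTypeR R => (z.1 ^+ 2 + z.2 ^+ 2)%R).
  by apply: measurable_funD; apply: measurable_funX.
have mq2 : measurable_fun setT
    (fun y : measurableTypeR R * (measurableTypeR R * measurableTypeR R) =>
      (y.2.1 ^+ 2 + y.2.2 ^+ 2)%R).
  exact: (measurableT_comp mq measurable_snd).
have mh : measurable_fun setT h by apply: measurable_funD.
(* At the pivot column [Y] is still zero and the phase rotation alone does the step. *)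
have [ks|ks] := eqVneq (val k) s.
  have kc : k = col by apply: val_inj; rewrite /= ks row_col.
  exists X1, Y'; split => //.
  - by split => //; exact: (gauss_given_comp mh G2).
  - by rewrite ks => /eqP; rewrite -[X in _ == X]addn0 -addn1 eqn_add2l.
  - move=> w j; rewrite ks ltnS -eqn_leq => /eqP sj.
    have -> : j = k by apply: val_inj; rewrite /= -sj ks.
    by rewrite X1k kc eqxx /Y' (Ys ks) add0r.
have ck : col != k by rewrite -(inj_eq val_inj)/= -row_col eq_sym.
have msq : measurable_fun setT (@Num.sqrt R).
  by apply: continuous_measurable_fun; exact: sqrt_continuous.
pose f2 (y : measurableTypeR R * (measurableTypeR R * measurableTypeR R)) :
  measurableTypeR R * measurableTypeR R :=
  (Num.sqrt y.1, Num.sqrt (y.2.1 ^+ 2 + y.2.2 ^+ 2)).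
have mf2 : measurable_fun setT f2.
  apply: measurable_fun_pair; first exact: (measurableT_comp msq measurable_fst).
  exact: (measurableT_comp msq mq2).
have mc2 := measurableT_comp measurable_unit_c mf2.
have ms2 := measurableT_comp measurable_unit_s mf2.
have cs2 y : (unit_c \o f2) y ^+ 2 + (unit_s \o f2) y ^+ 2 = 1 by exact: unit_cs1.
(* Rows below the pivot row have both columns in the Gaussian family; the pivot row has neither any
   more. *)
have K2 b i : ((i, (col, b)) \in row_set s k.+1) = ((i, (k, b)) \in row_set s k.+1).
  by rewrite !inE/= -row_col; move: ks sk; lia.
have ckb (b : bool) : (col, b) != (k, b) by rewrite xpair_eqE (negPf ck).
have G3 := gauss_given_slot_rot (ckb false) (K2 false) mc2 ms2 cs2
  (gauss_given_slot_rot (ckb true) (K2 true) mc2 ms2 cs2 G2).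
rewrite -/(col_rot _ _ _ _ _) in G3.
set X2 := col_rot _ _ _ _ _ in G3.
exists X2, Y'; split => //.
- by split => //; exact: (gauss_given_comp mh G3).
- by move=> w; rewrite gram_col_rot -?row_col//=; exact: unit_cs1.
- by move=> kE; move: sk; rewrite -kE ltnn.
- move=> w j /andP[sj jk]; rewrite entry_col_rot X1k.
  have -> : entry X1 row col w = (Num.sqrt (Y w))%:C%C.
    rewrite entry_phase_rot (negPf ck) rowX ?eqxx//.
    by rewrite -row_col leqnn ltn_neqAle eq_sym ks.
  rewrite /f2/= -!rmorphM -rmorphB -rmorphD.
  rewrite unit_cs_norm unit_cs_zero !sqr_sqrtr ?addr_ge0 ?sqr_ge0//.
  case: eqVneq => // jc; case: eqVneq => // jk'.
  rewrite entry_phase_rot (negPf jk') rowX ?(negPf jc)// sj/=.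
  by rewrite ltn_neqAle -ltnS jk andbT.
Qed.

Lemma row_state_full : gauss_given mu (fun=> 0 : measurableTypeR R) X0 (box s) ->
  exists X Y, row_state n X Y.
Proof.
move=> G0.
suff H t : (s <= t)%N -> (t <= n)%N -> exists X Y, row_state t X Y.
  by apply: H => //; rewrite row_col ltnW.
elim: t => [|t IH] st tn.
  exists X0, (fun=> 0); split => //.
  - rewrite sub0n; apply: gamma_given_zero.
    rewrite (_ : row_set s 0 = box s)//; apply/setP => -[i [j b]].
    by rewrite !inE/=; lia.
  - by move=> w j; rewrite ltn0 andbF.
have [ts|ts] := ltnP t s.
  (* The induction effectively starts at column [s], with the empty sum [Y = 0]. *)
  have sE : s = t.+1 by apply/eqP; rewrite eqn_leq st ts.
  exists X0, (fun=> 0); split => //.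
  - rewrite sE subnn -sE; apply: gamma_given_zero.
    rewrite (_ : row_set s s = box s)//; apply/setP => -[i [j b]].
    by rewrite !inE/=; lia.
  - by move=> w j /andP[sj]; rewrite -sE ltnNge sj.
have [X [Y H]] := IH ts (ltnW tn).
exact: (@row_state_step (Ordinal tn) X Y ts H).
Qed.

End row_step.

End row_reduction.

(** * One stage: peeling off a row and a column, and the induction over stages *)

Section stage.
Context {d : measure_display} {T : measurableType d} {R : realType} {m n : nat}.
Local Notation J := ('I_m * ('I_n * bool))%type.
Local Notation C := R[i].
Implicit Types (X : J -> T -> R) (w : T).

(** What is still Gaussian while the entries below the pivot are added to the norm, those in rows
    before [r] being absorbed. It interpolates between [row_set s n], at [r = s.+1], and [box s.+1],
    at [r = m]. *)
Definition col_set (s r : nat) : {set J} := [set j : J |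
  ((s < j.1) && (s <= j.2.1) && ((j.2.1 == s :> nat) ==> (r <= j.1)))%N].

(** Clearing the row has left the entries below the pivot Gaussian and independent of [Y], so each
    squared modulus adds one exponential variable. *)
Lemma gamma_given_col (mu : {finite_measure set T -> \bar R}) X Y a
    (row : 'I_m) (col : 'I_n) : row = col :> nat ->
  gamma_given mu Y X (row_set row n) a ->
  gamma_given mu
    (fun w => Y w + \sum_(i < m | (row < i)%N) sqabs (entry X i col w))
    X (box row.+1) (a + (m - row.+1)).
Proof.
move=> rc G.
suff H r : (row < r)%N -> (r <= m)%N -> gamma_given mu
    (fun w => Y w + \sum_(i < m | (row < i < r)%N) sqabs (entry X i col w))
    X (col_set row r) (a + (r - row.+1)).
  have := H m (ltn_ord row) (leqnn m).
  rewrite (_ : col_set row m = box row.+1); last first.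
    by apply/setP => -[i [j b]]; rewrite !inE/=; have := ltn_ord i; lia.
  congr gamma_given; apply/funext => w; congr (_ + _).
  by apply: eq_bigl => i; rewrite ltn_ord andbT.
elim: r => // r IH; rewrite ltnS => rr rm.
have [rowr|rowr] := ltnP row r; last first.
  have rE : r = row by apply/eqP; rewrite eqn_leq rr rowr.
  rewrite rE subnn addn0 (_ : col_set row row.+1 = row_set row n); last first.
    by apply/setP => -[i [j b]]; rewrite !inE/=; have := ltn_ord j; lia.
  rewrite (_ : (fun w => _) = Y)//; apply/funext => w.
  rewrite big_pred0 ?addr0// => i.
  by lia.
have {}IH := IH rowr (ltnW rm).
pose k : 'I_m := Ordinal rm.
pose p : J := (k, (col, true)); pose q : J := (k, (col, false)).
have pq : p != q by rewrite /p /q !xpair_eqE !eqxx.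
have pK : p \in col_set row r by rewrite inE/= -rc eqxx leqnn rowr leqnn.
have qK : q \in col_set row r by rewrite inE/= -rc eqxx leqnn rowr leqnn.
have := gamma_given_add pq pK qK IH; rewrite -addnS -subSn//.
rewrite (_ : col_set row r :\ p :\ q = col_set row r.+1); last first.
  apply/setP => -[i [j b]]; rewrite !inE /p /q !xpair_eqE/=.
  rewrite -(inj_eq val_inj)/= -(inj_eq val_inj j)/= -rc.
  by case: b; rewrite ?andbT ?andbF/=; lia.
congr gamma_given; apply/funext => w; rewrite -addrA; congr (_ + _).
rewrite [RHS](bigD1 k)/=; last by rewrite rowr ltnS leqnn.
rewrite addrC; congr (_ + _); apply: eq_bigl => i.
by rewrite -(inj_eq val_inj)/=; lia.
Qed.

(** Outside the pivot column the pivot row vanishes, so masking this row along with the column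
    removes nothing but the column's own contribution [u u^H]. *)
Lemma gram_split X (row : 'I_m) (col : 'I_n) w : row = col :> nat ->
  (forall j : 'I_n, (col < j)%N -> entry X row j w = 0) ->
  let u := \col_(i < m) (masked X row w i col) in
  gram X row w = gram X row.+1 w + u *m ctrmx u.
Proof.
move=> rc row0 u; apply/matrixP => i k.
rewrite [LHS]mxE [RHS]mxE [in RHS](mxE _ _ i k) [X in _ = _ + X]mxE big_ord1.
rewrite (bigD1 col)//= [in RHS](bigD1 col)//=.
have z l : masked X row.+1 w l col = 0 by rewrite mxE -rc ltnn andbF.
rewrite z mul0r add0r addrC; congr (_ + _); last by rewrite !mxE.
apply: eq_bigr => j jc; rewrite !mxE.
have H (l : 'I_m) : (if (row <= l)%N && (row <= j)%N then entry X l j w else 0) =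
    (if (row < l)%N && (row < j)%N then entry X l j w else 0).
  have [jlt|jgt|jE] := ltngtP row j.
  - rewrite !andbT; case: ltngtP => // /val_inj <-.
    by rewrite row0// -rc.
  - by rewrite !andbF.
  - by move: jc; rewrite -(inj_eq val_inj)/= -jE rc eqxx.
by rewrite !H.
Qed.

(** The parameter counts the exponential variables in [|u|^2]: [n - row] are collected in the
    squared pivot, [m - row.+1] lie below it. *)
Lemma stage (mu : {finite_measure set T -> \bar R}) X0 (row : 'I_m) (col : 'I_n) :
  row = col :> nat ->
  gauss_given mu (fun=> 0 : measurableTypeR R) X0 (box row) ->
  exists X (Delta : T -> measurableTypeR R),
    gamma_given mu Delta X (box row.+1) ((n - row) + (m - row.+1)) /\
    forall w, exists2 u : 'cV[C]_m, sqnorm u = Delta w &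
      gram X0 row w = gram X row.+1 w + u *m ctrmx u.
Proof.
move=> rc /(row_state_full rc)[X [Y [G gramX Y0 _ rowX]]].
exists X; eexists; split; first exact: (gamma_given_col rc G).
move=> w; exists (\col_(i < m) (masked X row w i col)); last first.
  rewrite -gramX; apply: gram_split => // j cj.
  rewrite rowX ?ltn_ord ?andbT; last by rewrite rc ltnW.
  by rewrite -(inj_eq val_inj)/= gtn_eqF.
rewrite /sqnorm (bigID (fun i : 'I_m => (row < i)%N))/= addrC; congr (_ + _).
  rewrite (bigD1 row) ?ltnn//= big_ord1 !mxE leqnn -rc leqnn/=.
  rewrite rowX ?eqxx; last by rewrite rc leqnn ltn_ord.
  rewrite {1}/sqabs/= expr0n addr0 sqr_sqrtr// big1 ?addr0// => i /andP[ri ir].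
  rewrite big_ord1 !mxE (_ : (row <= i)%N = false).
    by rewrite /sqabs/= expr0n/= addr0.
  apply/negbTE; rewrite -ltnNge ltn_neqAle ir/= leqNgt//.
apply: eq_bigr => i ri.
by rewrite big_ord1 !mxE (ltnW ri) rc leqnn.
Qed.

Lemma masked_large X s w : (minn n m <= s)%N -> masked X s w = 0.
Proof.
move=> ns; apply/matrixP => i j; rewrite !mxE; case: ifP => // /andP[si sj].
by have := ltn_ord i; have := ltn_ord j; lia.
Qed.

(** The remaining stages are run under the measure restricted to [Delta < xi s], whose total mass
    supplies the next factor [gamma_cdf]; this is where the independence of the stages enters. At
    the end of the recursion both sides equal 1, so strictness is claimed only when at least one
    stage is left. *)
Lemma det_bound_event (c : R) (xi : nat -> R) (mu : {finite_measure set T -> \bar R})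
    X (s : nat) : 0 < c -> (forall l, 0 < xi l) -> (s <= minn n m)%N ->
  gauss_given mu (fun=> 0 : measurableTypeR R) X (box s) ->
  exists E, [/\ measurable E,
    mu E = (mu setT * (\prod_(s <= l < minn n m)
       gamma_cdf (n + m - l.*2 - 1) (xi l))%:E)%E &
    forall w, E w ->
      let D := complex.Re (\det (shifted_gram c (masked X s w))) in
      let B := \prod_(s <= l < minn n m) (1 + c * xi l) in
      D <= B /\ ((s < minn n m)%N -> D < B)].
Proof.
move=> c0 xi0.
move: {2}(minn n m - s)%N (erefl (minn n m - s)%N) => k.
elim: k s mu X => [|k IH] s mu X kE sn G.
  have sE : s = minn n m by apply/eqP; rewrite eqn_leq sn -subn_eq0 kE.
  exists setT; split => //; first by rewrite sE big_geq// mule1.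
  move=> w _ /=; rewrite sE big_geq// ltnn masked_large//; split => //.
  by rewrite /shifted_gram mul0mx scaler0 addr0 det1.
have slt : (s < minn n m)%N by rewrite -subn_gt0 kE.
have [sn' sm'] : (s < n)%N /\ (s < m)%N by apply/andP; rewrite -leq_min.
have [X' [Delta [G' HX']]] := @stage mu X (Ordinal sm') (Ordinal sn') erefl G.
have [[mD mX' _] law'] := G'.
pose A := `]-oo, xi s[%classic : set (measurableTypeR R).
have mA : measurable A by exact: measurable_itv.
have mDA : measurable (Delta @^-1` A) by rewrite -[_ @^-1` _]setTI; exact: mD.
pose mu' := law_on mu (@measurable_id _ T setT) mDA.
have Gr : gauss_given mu' (fun=> 0 : measurableTypeR R) X' (box s.+1).
  have := gauss_given_comp (@measurable_cst _ _ _ _ setT (0 : measurableTypeR R))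
    (gauss_given_restrict mDA mA G'.1).
  by [].
have [|E [mE muE HE]] := IH s.+1 mu' X' _ slt Gr; first by rewrite subnS kE.
exists (Delta @^-1` A `&` E); split.
- exact: measurableI.
- rewrite (big_ltn slt) EFinM muleA; apply: (etrans muE); congr (_ * _)%E.
  transitivity (mu (Delta @^-1` A)); first by rewrite /mu' /= /law_on preimage_setT setIT.
  transitivity (mu [set w | (Delta w < xi s)%R]).
    by congr (mu _); apply/seteqP; split => w /=; rewrite /A/= in_itv.
  rewrite law' /=; congr (_ * (gamma_cdf _ _)%:E)%E.
  by have := sn'; have := sm'; lia.
move=> w [/=]; rewrite /A/= in_itv/= => Dxi /HE[le1 _].
have [u uE gramE] := HX' w.
have det1 := @Re_det_shifted_gram_le _ c (ltW c0) _ _ _ _ _ _ gramE.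
have B1 : 0 < 1 + c * xi s by rewrite ltr_pwDl// mulr_ge0 ?ltW.
suff lt1 : complex.Re (\det (shifted_gram c (masked X s w))) <
    \prod_(s <= l < minn n m) (1 + c * xi l) by split => //; exact: ltW.
apply: (le_lt_trans det1); rewrite (big_ltn slt) mulrC.
apply: (@lt_le_trans _ _ ((1 + c * xi s) *
    complex.Re (\det (shifted_gram c (masked X' s.+1 w))))).
  rewrite ltr_pM2r ?Re_det_shifted_gram_gt0 ?ltW//.
  by rewrite ltrD2l ltr_pM2l// uE.
by rewrite ler_wpM2l// ltW.
Qed.

End stage.

(** * The outage event *)

Section complex_measurability.
Context {d : measure_display} {T : measurableType d} {R : realType}.
Local Notation C := R[i].

Definition cmeasurable (f : T -> C) : Prop :=
  measurable_fun setT (fun w => complex.Re (f w)) /\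
  measurable_fun setT (fun w => complex.Im (f w)).

Lemma cmeasurable_cst (z : C) : cmeasurable (fun=> z).
Proof. by split; exact: measurable_cst. Qed.

Lemma cmeasurableD f g : cmeasurable f -> cmeasurable g ->
  cmeasurable (fun w => f w + g w).
Proof.
move=> [f1 f2] [g1 g2]; split.
  rewrite (_ : (fun w => _) = (fun w => complex.Re (f w) + complex.Re (g w))).
    exact: measurable_funD.
  by apply/funext => w; case: (f w) => ? ?; case: (g w).
rewrite (_ : (fun w => _) = (fun w => complex.Im (f w) + complex.Im (g w))).
  exact: measurable_funD.
by apply/funext => w; case: (f w) => ? ?; case: (g w).
Qed.

Lemma cmeasurableM f g : cmeasurable f -> cmeasurable g ->
  cmeasurable (fun w => f w * g w).
Proof.
move=> [f1 f2] [g1 g2]; split.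
  rewrite (_ : (fun w => _) = (fun w => complex.Re (f w) * complex.Re (g w) -
     complex.Im (f w) * complex.Im (g w))).
    by apply: measurable_funB; exact: measurable_funM.
  by apply/funext => w; case: (f w) => ? ?; case: (g w).
rewrite (_ : (fun w => _) = (fun w => complex.Re (f w) * complex.Im (g w) +
   complex.Im (f w) * complex.Re (g w))).
  by apply: measurable_funD; exact: measurable_funM.
by apply/funext => w; case: (f w) => ? ?; case: (g w).
Qed.

Lemma cmeasurable_conj f : cmeasurable f -> cmeasurable (fun w => (f w)^*%C).
Proof.
move=> [f1 f2]; split.
  by rewrite (_ : (fun w => _) = (fun w => complex.Re (f w)))//;
    apply/funext => w; case: (f w).
rewrite (_ : (fun w => _) = (fun w => - complex.Im (f w))).
  exact: measurableT_comp.
by apply/funext => w; case: (f w).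
Qed.

Lemma cmeasurable_sum (I : Type) (r : seq I) (Q : pred I) (f : I -> T -> C) :
  (forall i, cmeasurable (f i)) -> cmeasurable (fun w => \sum_(i <- r | Q i) f i w).
Proof.
move=> mf; elim: r => [|i r IH].
  rewrite (_ : (fun w => _) = fun=> 0); first exact: cmeasurable_cst.
  by apply/funext => w; rewrite big_nil.
rewrite (_ : (fun w => _) = (fun w => (if Q i then f i w else 0) +
    \sum_(i <- r | Q i) f i w)).
  by apply: cmeasurableD => //; case: (Q i) => //; exact: cmeasurable_cst.
by apply/funext => w; rewrite big_cons; case: (Q i); rewrite ?add0r.
Qed.

Lemma cmeasurable_prod (I : Type) (r : seq I) (f : I -> T -> C) :
  (forall i, cmeasurable (f i)) -> cmeasurable (fun w => \prod_(i <- r) f i w).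
Proof.
move=> mf; elim: r => [|i r IH].
  rewrite (_ : (fun w => _) = fun=> 1); first exact: cmeasurable_cst.
  by apply/funext => w; rewrite big_nil.
rewrite (_ : (fun w => _) = (fun w => f i w * \prod_(i <- r) f i w)).
  exact: cmeasurableM.
by apply/funext => w; rewrite big_cons.
Qed.

(** The determinant is a polynomial in the entries. The measurability of the outage event, which
    monotonicity of [P] requires, rests on this. *)
Lemma cmeasurable_det p (A : T -> 'M[C]_p) :
  (forall i j, cmeasurable (fun w => A w i j)) ->
  cmeasurable (fun w => \det (A w)).
Proof.
move=> mA; apply: cmeasurable_sum => s.
apply: cmeasurableM; first exact: cmeasurable_cst.
exact: cmeasurable_prod.
Qed.

Lemma cmeasurable_det_shifted_gram (c : R) p q (M : T -> 'M[C]_(p, q)) :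
  (forall i j, cmeasurable (fun w => M w i j)) ->
  cmeasurable (fun w => \det (shifted_gram c (M w))).
Proof.
move=> mM; apply: cmeasurable_det => i j.
rewrite (_ : (fun w => _) = (fun w => (1%:M : 'M[C]_p) i j +
  (c%:C)%C * \sum_k (M w i k * (M w j k)^*%C))); last first.
  apply/funext => w; rewrite /shifted_gram [LHS]mxE [X in _ + X]mxE [X in _ * X]mxE.
  by congr (_ + _ * _); apply: eq_bigr => k _; rewrite !mxE.
apply: cmeasurableD; first exact: cmeasurable_cst.
apply: cmeasurableM; first exact: cmeasurable_cst.
apply: cmeasurable_sum => k.
by apply: cmeasurableM => //; exact: cmeasurable_conj.
Qed.

End complex_measurability.

Section iid_gauss_given.
Context {R : realType} {d : measure_display} {T : measurableType d}.
Context {P : probability T R} {m n : nat}.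
Variable X : 'I_m * 'I_n * bool -> {RV P >-> R}.

(** Start of the induction, with a constant conditioning variable. The index is regrouped into a row
    and a slot, as column operations act on slots. *)
Lemma iid_gauss_given : iid_CN01 X ->
  gauss_given P (fun=> 0 : measurableTypeR R)
    (fun j : 'I_m * ('I_n * bool) => X (j.1, j.2.1, j.2.2) : T -> R) (box 0).
Proof.
move=> [indep law]; split => //.
move=> A B mA mB.
pose I' : finType := ('I_m * 'I_n * bool)%type.
pose B' (i : I') : set R := B (i.1.1, (i.1.2, i.2)).
pose F : {set I'} := [set: I']%SET.
have E : [set w | forall j : 'I_m * ('I_n * bool), j \in box 0 ->
    B j (X (j.1, j.2.1, j.2.2) w)] =
    \big[setI/setT]_(i in F) (X i @^-1` B' i).
  rewrite -bigcap_seq_cond; apply/seteqP; split => w /=.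
    by move=> h [[i j] b] _; apply: (h (i, (j, b))); rewrite inE.
  move=> h [i [j b]] _; apply: (h (i, j, b)).
  by rewrite /= mem_index_enum inE.
have PE : P [set w | forall j : 'I_m * ('I_n * bool), j \in box 0 ->
    B j (X (j.1, j.2.1, j.2.2) w)] = (\big[*%E/1]_(j in box 0) half_normal (B j))%E.
  rewrite E indep; last by move=> i; exact: mB.
  rewrite (reindex (fun j : 'I_m * ('I_n * bool) => (j.1, j.2.1, j.2.2)))/=; last first.
    exists (fun i => (i.1.1, (i.1.2, i.2))); first by move=> [i [j b]].
    by move=> [[i j] b].
  apply: eq_big => [j|[i [j b]] _]; first by rewrite !inE.
  exact: (law (i, j, b) _ (mB (i, (j, b)))).
(* An event on a constant is either everything or empty. *)
have [A0|A0] := pselect (A 0).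
  rewrite (_ : _ @^-1` A = setT); last by apply/seteqP; split.
  rewrite probability_setT mul1e -PE; congr (P _).
  by apply/seteqP; split => w //= [].
rewrite (_ : _ @^-1` A = set0); last by apply/seteqP; split.
rewrite measure0 mul0e (_ : [set w | _] = set0) ?measure0//.
by apply/seteqP; split => w //= [].
Qed.

End iid_gauss_given.

Theorem theorem2 (R : realType) (d : measure_display) (T : measurableType d)
  (P : probability T R) (Nt Nm Ne : nat)
  (hNt : (0 < Nt)%N) (hNm : (0 < Nm)%N) (hNe : (0 < Ne)%N) (hNeNt : (Ne < Nt)%N)
  (X : 'I_Nm * 'I_(Nt - Ne) * bool -> {RV P >-> R})
  (hX : iid_CN01 X)
  (eta g rs : R) (heta : 0 < eta) (hg : 0 < g) (hrs : 0 < rs)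
  (a : 'I_(minn (Nt - Ne) Nm) -> R)
  (ha_pos : forall l, 0 < a l)
  (ha_mono : forall l1 l2 : 'I_(minn (Nt - Ne) Nm), (l1 <= l2)%N -> a l2 <= a l1)
  (ha_sum : \sum_(l < minn (Nt - Ne) Nm) a l = rs) :
  ((\prod_(l < minn (Nt - Ne) Nm)
      Gamma_inc (xi (Nt - Ne) eta g (a l))
        (maxn (Nt - Ne) Nm + minn (Nt - Ne) Nm - (l.+1).*2 + 1))%:E
   <= P_out_ZF X eta g rs)%E.
Proof.
set n := (Nt - Ne)%N in X hX a ha_pos ha_mono ha_sum *.
have n0 : (0 < n)%N by rewrite subn_gt0.
have mn0 : (0 < minn n Nm)%N by rewrite leq_min n0.
have nR : 0 < n%:R :> R by rewrite ltr0n.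
pose c := eta / n%:R.
have c0 : 0 < c by rewrite divr_gt0.
have b1 : 1 < 1 + g * eta by rewrite ltrDl mulr_gt0.
have b0 : 0 < 1 + g * eta by rewrite (lt_trans ltr01).
(* [det_bound_event] takes a positive threshold for every natural number; 1 is an arbitrary positive
   default outside the range. *)
pose x (l : nat) : R := if insub l is Some o then xi n eta g (a o) else 1.
have xE (l : 'I_(minn n Nm)) : x l = xi n eta g (a l) by rewrite /x valK.
have xi0 (l : 'I_(minn n Nm)) : 0 < xi n eta g (a l).
  rewrite /xi mulr_gt0 ?divr_gt0// subr_gt0 /powR gt_eqF//.
  by rewrite expR_gt1 mulr_gt0// ln_gt0.
have x0 l : 0 < x l by rewrite /x; case: insubP.
have [E [mE PE HE]] := det_bound_event c0 x0 (leq0n _) (iid_gauss_given hX).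
have -> : (\prod_(l < minn n Nm) Gamma_inc (xi n eta g (a l))
    (maxn n Nm + minn n Nm - (l.+1).*2 + 1))%:E = P E.
  transitivity (1%E * (\prod_(0 <= l < minn n Nm)
      gamma_cdf (n + Nm - l.*2 - 1) (x l))%:E)%E; last first.
    by rewrite -(@probability_setT _ _ _ P); apply/esym; exact: PE.
  rewrite mul1e big_mkord; congr (_%:E).
  (* The indices agree because max and min add up to [n + Nm], and [l < minn n Nm] keeps the natural
     subtractions from truncating. *)
  apply: eq_bigr => l _; rewrite xE addn1 -gamma_cdfE//; congr gamma_cdf.
  by have := ltn_ord l; lia.
(* [xi] is the solution of [1 + c * xi(a) = (1 + g * eta) ^ a], so the exponents add up to [rs]. *)
have prodE : \prod_(0 <= l < minn n Nm) (1 + c * x l) = (1 + g * eta) `^ rs.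
  have pD : {morph powR (1 + g * eta) : r s / r + s >-> r * s}.
    by move=> r s; rewrite powRD// [in X in _ ==> X]gt_eqF// implybT.
  rewrite -ha_sum (big_morph _ pD (powRr0 _)) big_mkord; apply: eq_bigr => l _; rewrite xE /xi /c.
  by field; rewrite !gt_eqF.
have maskE w : masked (fun j : 'I_Nm * ('I_n * bool) =>
    X (j.1, j.2.1, j.2.2) : T -> R) 0 w = gauss_mx X w.
  by apply/matrixP => i j; rewrite !mxE.
rewrite /P_out_ZF; apply: le_measure; rewrite ?inE//.
- have mentry i j : cmeasurable (fun w => gauss_mx X w i j).
    rewrite (_ : (fun w => _) =
      fun w => Complex (X (i, j, true) w) (X (i, j, false) w)).
      by split; exact: measurable_funPT.
    by apply/funext => w; rewrite mxE.
  have [mdet _] := cmeasurable_det_shifted_gram c mentry.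
  have mln := measurableT_comp (@measurable_ln R) mdet.
  rewrite (_ : [set w | _] = setT `&` (@ln R \o (fun w =>
    complex.Re (\det (shifted_gram c (gauss_mx X w))))) @^-1`
    `]-oo, rs * ln (1 + g * eta)[%classic).
    by apply: mln => //; exact: measurable_itv.
  by rewrite setTI; apply/seteqP; split => w /=; rewrite in_itv.
(* The product is nonempty by [mn0], which gives the strict inequality that the outage event
   demands. *)
move=> w Ew /=; have [_ /(_ mn0)] := HE w Ew; rewrite prodE maskE => lt.
by rewrite -ln_powR ltr_ln// posrE ?powR_gt0// Re_det_shifted_gram_gt0// ltW.
Qed.
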